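(* Let $d\ge1$, $n\ge0$, $N=n+2d+1$, and let $\mathcal{T}$ be a triangulation of $C(N,2d)$ such that $Q(\mathcal{T})$ is isomorphic to a cut quiver $Q^{(d,n)}_C$ for a cut $C$ of $Q^{(d,n)}$; the isomorphism is realised through a slice $S$ of $\tilde Q^{(d,n)}$ such that $\pi$ restricts to an isomorphism of quivers $S\to Q(\mathcal{T})$, with $C$ the cut corresponding to $S$ (identification described in the context). Let $A=(a_0,\dots,a_d)$ be a vertex of $S$ (equivalently of $Q(\mathcal{T})$) which is neither a sink nor a source of $Q(\mathcal{T})$, but is not in the middle of any retrograde path in $Q(\mathcal{T})$. Let $\mathcal{T}'$ be the result of performing a bistellar flip at $A$ in $\mathcal{T}$. Then: (1) In the bistellar flip, $A$ is replaced by the $d$-arc $(a_0+1,a_1+1,\dots,a_{i-1}+1,\,a_{i+1}-1,\,a_{i+1}+1,\dots,a_d+1)$, entries taken modulo $N$, where $i$ is the type of the arrow cut out of the distinguished cut $(d+1)$-cycles at $A$ (and $a_{d+1}:=a_0+N$). (2) $Q(\mathcal{T}')$ is obtained from $Q(\mathcal{T})$, presented as the quiver $Q^{(d,n)}$ with the arrows of $C$ removed, by removing from $C$ the arrows which begin or end at $A$ and adding to $C$ the arrows of $Q^{(d,n)}_1\setminus C$ which begin or end at $A$. That is, $Q(\mathcal{T}')$ is isomorphic to the quiver obtained from $Q^{(d,n)}$ by removing the arrows of the resulting set $C'$; here the $d$-arc replacing $A$ corresponds to the vertex of $Q^{(d,n)}$ previously corresponding to $A$, and every other $d$-arc corresponds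 to the same vertex as before.
   Context: Cyclic polytopes and triangulations. $C(N,2d)$ is the convex hull of $N$ points $p_{t_1},\dots,p_{t_N}$, $t_1<\dots<t_N$, on the moment curve $p_t=(t,t^2,\dots,t^{2d})$, with vertices labelled by $[N]=\{1,\dots,N\}$. A triangulation is a collection of $(2d+1)$-subsets of $[N]$ whose convex hulls have pairwise disjoint interiors and union $C(N,2d)$. A $d$-arc of $\mathcal{T}$ is a $(d+1)$-subset of $[N]$ that is a face of a $2d$-simplex of $\mathcal{T}$ and is not contained in a facet of $C(N,2d)$. The set of all $d$-simplices not contained in a facet is ${\mathbf I}=\{(a_0,\dots,a_d)\in[N]^{d+1}: a_{i+1}\ge a_i+2\ (0\le i<d),\ a_d+2\le a_0+N\}$. Labels are taken modulo $N$ with representatives $[N]$, and tuples are considered up to cyclic shift. $A,B$ are intertwining if, for suitable cyclic indexing, $a_0<b_0<a_1<\dots<a_d<b_d$ in some cyclically shifted order on $[N]$. Put $A-\mathbf 1=(a_0-1,\dots,a_d-1)$. The quiver $Q(\mathcal{T})$ has the $d$-arcs of $\mathcal{T}$ as vertices and an arrow $A\to B$ for $A\ne B$ whenever $A-\mathbf 1$, $B$ are intertwining and there is no $d$-arc $A'\notin\{A,B\}$ of $\mathcal{T}$ with $A-\mathbf 1$, $A'$ intertwining and $A'-\mathbf 1$, $B$ intertwining. Every arrow has the form $A\to A+rE_i$ ($a_i$ replaced by $a_i+r$, $r\geq 1$, with $a_i<a_i+r<a_{i+1}$ cyclically; indices modulo $d+1$). Flips. A bistellar flip at a $d$-arc $A$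 of $\mathcal{T}$ is a triangulation $\mathcal{T}'$ whose $d$-arcs are those of $\mathcal{T}$ with $A$ replaced by a single different $d$-arc $B$; such $\mathcal{T}'$ is unique if it exists, and it exists if $A$ is not in the middle of any retrograde path. Retrograde paths. A path $A\to A+rE_i\to A+rE_i+sE_{i-1}$ in $Q(\mathcal{T})$ is retrograde at $A+rE_i$ if $a_{i-1}<a_{i-1}+s<a_i$ cyclically. A path $A_0\to\dots\to A_{l+1}$ is retrograde if it is retrograde at each of $A_1,\dots,A_l$, and these vertices are said to be in its middle; single arrows are trivially retrograde. Cuts. $Q^{(d,n)}$ has vertices $\{(c_0,\dots,c_d)\in\mathbb{Z}_{\ge0}^{d+1}:\sum c_k=n-1\}$ and set of arrows $Q^{(d,n)}_1=\{x\to x+f_k\}$ ($x$, $x+f_k$ vertices, $0\le k\le d$), where $f_k$ has $-1$ in coordinate $k$ and $+1$ in coordinate $k+1$ (coordinates modulo $d+1$). A cut $C$ is a set of arrows containing exactly one arrow of each directed $(d+1)$-cycle, and the cut quiver $Q^{(d,n)}_C$ is $Q^{(d,n)}$ with the arrows in $C$ removed. A $(d+1)$-cycle is distinguished if its arrows are labelled in the cyclic order $f_0,f_1,\dots,f_d$. The distinguished cut $(d+1)$-cycles of $Q^{(d,n)}_C$ are the paths obtained from the distinguished cycles by removing their arrow lying in $C$ (the arrow ''cut out''); the distinguished cut cycles at a vertex are those passing through it, including at an endpoint. Slices. $\tilde Q^{(d,n)}$ has vertices $\{(a_0,\dots,a_d)\in\mathbb{Z}^{d+1}: a_{i+1}\ge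 a_i+2\ (0\le i<d),\ a_d+2\le a_0+N\}$ and arrows $A\to A+E_i$, with $E_i$ the $i$-th unit vector. $\nu_d$ is the automorphism $A\mapsto A-\mathbf 1$. A slice is a full subquiver $S$ containing exactly one vertex from each $\nu_d$-orbit and such that any path in $\tilde Q^{(d,n)}$ between two vertices of $S$ has all its vertices in $S$. The map $\pi$ reduces entries modulo $N$ to $[N]$ and sorts. The $\nu_d$-orbit of $A$ corresponds to the vertex $(c_0,\dots,c_d)$ of $Q^{(d,n)}$ with $c_{d-i}=a_{i+1}-a_i-2$, where $a_{d+1}=a_0+N$. Under this correspondence, an arrow $A\to A+E_i$ of $S$ becomes an arrow labelled $f_{d-i}$, the quiver $S$ becomes $Q^{(d,n)}_C$ for a cut $C$, and an arrow of $Q^{(d,n)}$ labelled $f_{d-i}$ is said to be of type $i$. The quiver $Q(\mathcal{T})$ is isomorphic to a cut quiver precisely when such a slice $S$ exists. At the vertex $A$ of the claim, the arrows cut out of the distinguished cut cycles at $A$ all have the same type.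
   Formalization: Part (2) is stated only for d ≥ 2, since it is false for d = 1: flipping 03 in the hexagon triangulation with arcs 02, 03, 04 gives a quiver that is an oriented 3-cycle, while the mutated cut quiver is a path. Part (1) is stated for all d ≥ 1. *)

(* Defs.v *)
From HB Require Import structures.
From mathcomp Require Import all_boot all_order all_algebra.
From mathcomp Require Import all_classical all_reals all_analysis.

Set Implicit Arguments.
Unset Strict Implicit.
Unset Printing Implicit Defensive.

Import Order.TTheory GRing.Theory Num.Theory numFieldNormedType.Exports.

Local Open Scope classical_set_scope.
Local Open Scope ring_scope.

(* No quiver below has parallel arrows, so an arrow is determined by its two
   ends. *)
Record quiver (V : Type) := Quiver {
  qvert : set V;
  qarr : V -> V -> Prop }.

Definition quiver_iso (V W : Type) (f : V -> W) (P : quiver V) (Q : quiver W) :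
    Prop :=
  set_bij (qvert P) (qvert Q) f /\
  forall x y, qvert P x -> qvert P y -> (qarr P x y <-> qarr Q (f x) (f y)).

Definition is_sink (V : Type) (Q : quiver V) (x : V) : Prop :=
  forall y, ~ qarr Q x y.

Definition is_source (V : Type) (Q : quiver V) (x : V) : Prop :=
  forall y, ~ qarr Q y x.

(* The element x of 'I_N, whose value is in {0, .., N - 1}, stands for the
   label x + 1 in [N] = {1, .., N}. *)
Section CyclicPolytope.
Variables (R : realType) (d N : nat) (t : 'I_N -> R).

Definition moment_point (x : R) : 'rV[R]_(2 * d) :=
  \row_(j < 2 * d) x ^+ j.+1.

Definition hull (X : {set 'I_N}) : set 'rV[R]_(2 * d) :=
  [set v | exists w : 'I_N -> R,
     [/\ forall i, 0 <= w i, \sum_(i in X) w i = 1 &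
         v = \sum_(i in X) w i *: moment_point (t i)]].

Definition cyclic_polytope : set 'rV[R]_(2 * d) := hull [set: 'I_N]%SET.

(* Homogeneous coordinates turn affine independence into linear independence. *)
Definition affinely_independent (m k : nat) (q : 'I_k -> 'rV[R]_m) : Prop :=
  row_free (\matrix_(i < k) row_mx (1%:M : 'M[R]_1) (q i)).

(* The facets are the faces of dimension 2d - 1: a face cut out by a proper
   hyperplane has at most that dimension, and has it exactly if it contains 2d
   affinely independent points. *)
Definition is_facet (F : set 'rV[R]_(2 * d)) : Prop :=
  exists (u : 'cV[R]_(2 * d)) (c : R),
    [/\ u != 0,
        forall v, cyclic_polytope v -> (v *m u) 0 0 <= c,
        F = cyclic_polytope `&` [set v | (v *m u) 0 0 = c] &
        exists2 q : 'I_(2 * d) -> 'rV[R]_(2 * d),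
          forall i, F (q i) & affinely_independent q].

Definition triangulation (T : {set {set 'I_N}}) : Prop :=
  [/\ forall X, X \in T -> #|X| = (2 * d + 1)%N,
      forall X Y, X \in T -> Y \in T -> X <> Y ->
        interior (hull X) `&` interior (hull Y) = set0 &
      \bigcup_(X in [set` T]) hull X = cyclic_polytope].

Definition darcs (T : {set {set 'I_N}}) : set {set 'I_N} :=
  [set A : {set 'I_N} | [/\ #|A| = d.+1,
               exists2 X, X \in T & A \subset X &
               forall F, is_facet F -> ~ (hull A `<=` F)]].

Definition bistellar_flip (T : {set {set 'I_N}}) (A : {set 'I_N})
    (T' : {set {set 'I_N}}) (B : {set 'I_N}) : Prop :=
  [/\ triangulation T', darcs T A, ~ darcs T B &
      darcs T' = (darcs T `\ A) `|` [set B]].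

End CyclicPolytope.

(* The position of x in the cyclically shifted order on 'I_N that starts at
   the element congruent to - s modulo N. *)
Definition shifted_pos (N s : nat) (x : 'I_N) : nat := ((x + s) %% N)%N.

Definition intertwining (d N : nat) (A B : {set 'I_N}) : Prop :=
  exists (s : nat) (a b : 'I_d.+1 -> 'I_N),
    [/\ A = [set a i | i : 'I_d.+1]%SET,
        B = [set b i | i : 'I_d.+1]%SET,
        forall i, (shifted_pos s (a i) < shifted_pos s (b i))%N &
        forall i j : 'I_d.+1, j = i.+1 :> nat ->
          (shifted_pos s (b i) < shifted_pos s (a j))%N].

Definition shift_down (N : nat) (A : {set 'I_N}) : {set 'I_N} :=
  [set ord_pred x | x in A]%SET.

(* Q(T), as a function of the set D of d-arcs of T. *)
Definition arc_quiver (d N : nat) (D : set {set 'I_N}) : quiver {set 'I_N} :=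
  Quiver D (fun A B =>
    [/\ D A, D B, A <> B, intertwining d (shift_down A) B &
        ~ exists A', [/\ D A', A' <> A, A' <> B,
                         intertwining d (shift_down A) A' &
                         intertwining d (shift_down A') B]]).

Definition vec (d : nat) := {ffun 'I_d.+1 -> int}.
HB.instance Definition _ d := GRing.Zmodule.on (vec d).

Definition unitvec (d : nat) (i : 'I_d.+1) : vec d :=
  [ffun j => if j == i then 1 else 0].

(* a_(i+1), with a_(d+1) = a_0 + N. *)
Definition next_entry (d N : nat) (a : vec d) (i : 'I_d.+1) : int :=
  a (ordS i) + (if i == ord_max then N%:Z else 0).

Definition tvert (d N : nat) (a : vec d) : bool :=
  [forall i, a i + 2 <= next_entry N a i].

Definition tarrow (d N : nat) : rel (vec d) := fun a b =>
  [&& tvert N a, tvert N b & [exists i, b == a + unitvec i]].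

Definition nu_orbit (d : nat) (a b : vec d) : Prop :=
  exists m : int, b = a - [ffun=> 1] *~ m.

Definition is_slice (d N : nat) (S : set (vec d)) : Prop :=
  [/\ S `<=` [set a | tvert N a],
      forall a, tvert N a -> exists! b, S b /\ nu_orbit a b &
      forall a p, path (@tarrow d N) a p -> S a -> S (last a p) ->
        forall b, b \in a :: p -> S b].

Definition slice_quiver (d N : nat) (S : set (vec d)) : quiver (vec d) :=
  Quiver S (fun a b => [/\ S a, S b & tarrow N a b]).

(* The map pi: a tuple is sent to the set of residues of its entries, where
   x : 'I_N is the label x + 1. *)
Definition arc_of (d N : nat) (a : vec d) : {set 'I_N} :=
  [set x : 'I_N | [exists i, (x.+1%:Z == a i %[mod N%:Z])%Z]]%SET.
Arguments arc_of {d} N a.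

(* The tuple a is an increasing lift to Z of the d-arc X; every cyclic shift of
   X has such a lift, and the cyclic inequalities become inequalities in Z. *)
Definition retrograde_at (d N : nat) (D : set {set 'I_N})
    (X Y Z : {set 'I_N}) : Prop :=
  qarr (arc_quiver d D) X Y /\ qarr (arc_quiver d D) Y Z /\
  exists (a : vec d) (i : 'I_d.+1) (r s : int),
    [/\ tvert N a,
        X = arc_of N a,
        Y = arc_of N (a + unitvec i *~ r) &
        Z = arc_of N (a + unitvec i *~ r + unitvec (ord_pred i) *~ s)] /\
    [/\ 0 < r, a i + r < next_entry N a i,
        0 < s & a (ord_pred i) + s < next_entry N a (ord_pred i)].

Definition retrograde_path (d N : nat) (D : set {set 'I_N})
    (p : seq {set 'I_N}) : Prop :=
  [/\ (1 < size p)%N,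
      forall j, (j.+1 < size p)%N ->
        qarr (arc_quiver d D) (nth finset.set0 p j) (nth finset.set0 p j.+1) &
      forall j, (j.+2 < size p)%N ->
        retrograde_at d D (nth finset.set0 p j) (nth finset.set0 p j.+1)
                          (nth finset.set0 p j.+2)].

Definition middle_of_retrograde (d N : nat) (D : set {set 'I_N})
    (X : {set 'I_N}) : Prop :=
  exists p j, [/\ retrograde_path d D p, (0 < j)%N, (j.+1 < size p)%N &
                  nth finset.set0 p j = X].

Section Cuts.
Variables (d n : nat).

Definition fvec (k : 'I_d.+1) : vec d := unitvec (ordS k) - unitvec k.

Definition cvert : set (vec d) :=
  [set x | (forall k, 0 <= x k) /\ \sum_k x k = n%:Z - 1].

(* An arrow x -> x + f_k is the pair (x, k). *)
Definition arrow : Type := (vec d * 'I_d.+1)%type.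

Definition target (e : arrow) : vec d := e.1 + fvec e.2.

Definition carrows : set arrow := [set e | cvert e.1 /\ cvert (target e)].

Fixpoint walk (x : vec d) (ks : seq 'I_d.+1) : seq (vec d * 'I_d.+1) :=
  if ks is k :: ks' then (x, k) :: walk (x + fvec k) ks' else [::].

Definition is_cycle (x : vec d) (ks : seq 'I_d.+1) : Prop :=
  [/\ size ks = d.+1,
      forall e, e \in walk x ks -> carrows e &
      x + \sum_(k <- ks) fvec k = x].

Definition is_cut (C : set arrow) : Prop :=
  C `<=` carrows /\
  forall x ks, is_cycle x ks -> exists! e, e \in walk x ks /\ C e.

Definition cut_quiver (C : set arrow) : quiver (vec d) :=
  Quiver cvert (fun x y =>
    exists k, [/\ carrows (x, k), ~ C (x, k) & y = target (x, k)]).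

Definition distinguished_cycle (x : vec d) (ks : seq 'I_d.+1) : Prop :=
  is_cycle x ks /\ exists m, ks = rot m (enum 'I_d.+1).

(* An arrow labelled f_(d-i) has type i. *)
Definition arrow_type (e : arrow) : 'I_d.+1 := rev_ord e.2.

Definition incident (y : vec d) : set arrow :=
  [set e | e.1 = y \/ target e = y].

(* i is the type of the arrow cut out of some distinguished cut cycle which
   passes through y. *)
Definition cut_out_type (C : set arrow) (y : vec d) (i : 'I_d.+1) : Prop :=
  exists x ks,
    [/\ distinguished_cycle x ks,
        exists2 e, e \in walk x ks & ~ C e /\ incident y e &
        exists2 e, e \in walk x ks & C e /\ arrow_type e = i].

Definition mutated_cut (C : set arrow) (y : vec d) : set arrow :=
  (C `\` incident y) `|` ((carrows `\` C) `&` incident y).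

(* The vertex (c_0, .., c_d) with c_(d-i) = a_(i+1) - a_i - 2. *)
Definition orbit_vertex (N : nat) (a : vec d) : vec d :=
  [ffun j => next_entry N a (rev_ord j) - a (rev_ord j) - 2].

(* An arrow a -> a + E_i of S becomes the arrow labelled f_(d-i) at the vertex
   of a; the arrows of the cut are those not obtained in this way. *)
Definition slice_cut (N : nat) (S : set (vec d)) : set arrow :=
  [set e | carrows e /\
           ~ exists a, [/\ S a, S (a + unitvec (arrow_type e)) &
                           orbit_vertex N a = e.1]].

End Cuts.

(* (a_0 + 1, .., a_(i-1) + 1, a_(i+1) - 1, a_(i+1) + 1, .., a_d + 1) *)
Definition flipped (d N : nat) (a : vec d) (i : 'I_d.+1) : vec d :=
  [ffun j => if j == i then next_entry N a i - 1 else a j + 1].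

(* Main.v *)
Require Import Defs.
From mathcomp Require Import all_boot all_order all_algebra.
From mathcomp Require Import all_classical all_reals all_analysis.
From mathcomp Require Import zify ring lra.

Set Implicit Arguments.
Unset Strict Implicit.
Unset Printing Implicit Defensive.

Import Order.TTheory GRing.Theory Num.Theory numFieldNormedType.Exports.

Local Open Scope classical_set_scope.
Local Open Scope ring_scope.

(** Lift arcs to increasing integer tuples, extended by a_(i+d+1) = a_i + N. Then
    X and Y intertwine if and only if they have lifts with x_i < y_i < x_(i+1)
    ([intertwiningP]), so that X - 1 and Y intertwine if and only if they have
    lifts with x_i <= y_i <= x_(i+1) - 2 ([precedesI], [precedes_liftl],
    [precedes_liftr]). All questions about the quivers become linear inequalities
    between entries.

    Geometry enters in two places. The coefficients of the affine dependence of
    2d + 2 points alternate in sign along the moment curve, so that intertwining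
    d-simplices cross in their relative interiors, and then any two 2d-simplices
    on them have common interior points: the arcs of a triangulation do not
    intertwine ([triangulation_noncrossing]). Conversely, a d-simplex B which is
    not a face of T crosses a face of T. Its centroid lies in a simplex X of T;
    this gives two weights with the same moments, and testing them against
    polynomials of degree 2d which vanish doubly on B, except simply at the ends
    of one gap of B, shows that X has a vertex in each gap
    ([crossing_simplex]). So the arc that replaces A crosses an arc of T, and as
    it crosses no arc of T', the crossed arc is A ([flip_intertwining]).

    The slice S determines the shape of A. By convexity, S contains no x and y
    with x + 1 <= y, and it contains v or v - 1 whenever x <= v <= x + 1 for some x
    in S. An index i with a_(i+1) - a_i >= 3 gives a distinguished cycle
    A -> A + E_i -> ... -> A + 1 - E_(i+1) -> A + 1, and if no retrograde path
    passes through A then the arrow cut out of it is the first or the last one.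
    Since A is neither a source nor a sink, both cases occur, the first for some j
    and the last for some i. Then S contains A - 1 + E_j and A + 1 - E_(i+1), which
    is impossible unless j = i + 1. Hence, with k = i + 1, all cut out arrows have
    type k, the gaps of A other than those at k - 1 and k are equal to 2, and S
    contains A + E_(k-1), A - E_(k+1), A + 1 - E_k and A - 1 + E_k ([flip_type]).
    The new arc interlaces A but neither A + E_(k-1) nor A - E_(k+1), which leaves
    only one possibility for its entries ([flipped_arc]).

    The same inequalities show that the only arrows at the new arc B are those
    from A + 1 - E_k and to A - 1 + E_k ([arrow_into_new], [arrow_from_new]), which
    up to a shift are the sources and targets of the arrows cut at A
    ([mutated_arrow_into], [mutated_arrow_from]). The other arrows could change
    only if A or B lay between two old arcs. B never does ([new_not_between]), and
    if A does, then so does A + E_(k-1) - E_(k+1), which lies in S by convexity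
    ([old_replaceable]); it is different from A exactly because k - 1 and k + 1 are
    distinct modulo d + 1 for d >= 2. *)

(** * Integer lifts of arcs *)

Section Vec.
Variable d : nat.
Implicit Types (a b : vec d) (i j : 'I_d.+1).

Lemma vec_ext a b : (forall i, a i = b i) -> a = b.
Proof. by move=> ab; apply/ffunP. Qed.

Lemma vecD a b i : (a + b) i = a i + b i.
Proof. exact: ffunE. Qed.

Lemma vecN a i : (- a) i = - a i.
Proof. exact: ffunE. Qed.

Lemma unitvecE i j : unitvec i j = (j == i)%:R :> int.
Proof. by rewrite ffunE; case: eqP. Qed.

Definition ones : vec d := [ffun=> 1].

Lemma onesE i : ones i = 1.
Proof. exact: ffunE. Qed.

Lemma onesM (m : int) i : (ones *~ m) i = m.
Proof.
have natE k : (ones *+ k) i = k%:Z.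
  elim: k => [|k IHk]; first by rewrite mulr0n ffunE.
  by rewrite mulrS vecD IHk onesE; lia.
case: m => k; first exact: natE.
by rewrite NegzE mulrNz vecN natE.
Qed.

Definition vecE := (vecD, vecN, unitvecE, onesM, onesE).

Lemma iter_ordS l i : nat_of_ord (iter l (@ordS _) i) = ((i + l) %% d.+1)%N.
Proof.
elim: l => [|l IHl] /=; first by rewrite addn0 modn_small.
by rewrite IHl -addn1 modnDml addn1 addnS.
Qed.

Lemma cyclic_ind (P : 'I_d.+1 -> Prop) i :
  P i -> (forall j, P j -> P (ordS j)) -> forall j, P j.
Proof.
move=> Pi PS j.
have Pk k : P (iter k (@ordS _) i) by elim: k => //= k; apply: PS.
have -> : j = iter (d.+1 - i + j)%N (@ordS _) i; last exact: Pk.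
apply: ord_inj; rewrite iter_ordS addnA subnKC; last exact: ltnW.
by rewrite modnDl modn_small.
Qed.

End Vec.

Section CyclicLifts.
Variables (d N : nat).
Implicit Types (a b x y : vec d) (i j : 'I_d.+1).

Local Notation next := (next_entry N).

Lemma ordS_cases i :
  (i = ord_max /\ ordS i = ord0) \/
  [/\ (i < d)%N, i != ord_max & nat_of_ord (ordS i) = i.+1].
Proof.
case: (eqVneq i ord_max) => [->|ne]; [left|right].
  by split => //; apply: val_inj; rewrite /= modnn.
have lt : (i < d)%N by move: ne (ltn_ord i); rewrite -val_eqE /=; lia.
by split=> //=; rewrite modn_small.
Qed.

Lemma ordS_neq i : (0 < d)%N -> ordS i != i.
Proof.
move=> d_gt0; rewrite -val_eqE -[val _]/(nat_of_ord (ordS i)).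
have [[-> ->]|[_ _ ->]] := ordS_cases i; last by rewrite /=; lia.
by rewrite /=; lia.
Qed.

Lemma ord_pred_neq i : (0 < d)%N -> ord_pred i != i.
Proof.
by move=> d_gt0; have := ordS_neq (ord_pred i) d_gt0; rewrite ord_predK eq_sym.
Qed.

Definition wrap i : int := if i == ord_max then N%:Z else 0.

Lemma nextE a i : next a i = a (ordS i) + wrap i.
Proof. by []. Qed.

Definition cyclic_increasing a := forall i, a i < next a i.

Lemma tvertP a : reflect (forall i, a i + 2 <= next a i) (tvert N a).
Proof. exact: forallP. Qed.

Lemma tvert_increasing a : tvert N a -> cyclic_increasing a.
Proof. by move=> /tvertP ta i; have := ta i; lia. Qed.

Lemma increasing_le a i j :
  cyclic_increasing a -> (i < j)%N -> a i < a j.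
Proof.
move=> inc lt.
have [m mE] : exists m : nat, (j = i + m.+1 :> nat)%N.
  by exists (j - i).-1; lia.
elim: m j {lt} mE => [|m IHm] j jE.
  have [[iE _]|[_ ne SE]] := ordS_cases i.
    by move: jE (ltn_ord j); rewrite iE /=; lia.
  have -> : j = ordS i by apply: ord_inj; rewrite SE; lia.
  by have := inc i; rewrite nextE /wrap (negPf ne); lia.
have lt : ((i + m.+1) < d.+1)%N by move: (ltn_ord j); lia.
have lt1 := IHm (Ordinal lt) erefl.
have [[iE _]|[_ ne SE]] := ordS_cases (Ordinal lt).
  by move/(congr1 val): iE (ltn_ord j) => /=; lia.
have -> : j = ordS (Ordinal lt) by apply: ord_inj; rewrite SE jE /=; lia.
by have := inc (Ordinal lt); rewrite nextE /wrap (negPf ne); lia.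
Qed.

Lemma increasing_window a i :
  cyclic_increasing a -> a ord0 <= a i /\ a i < a ord0 + N%:Z.
Proof.
move=> inc; have maxP : a ord_max < a ord0 + N%:Z.
  have := inc ord_max; rewrite nextE /wrap eqxx.
  by have [[_ ->]|[]] := ordS_cases (@ord_max d); rewrite ?ltnn.
split.
  case: (posnP i) => [i0|]; first by have -> : i = ord0 by exact: val_inj.
  by move=> /(@increasing_le a ord0 i inc); lia.
case: (eqVneq i ord_max) => [->//|ne].
have lt : (i < d)%N by move: ne (ltn_ord i); rewrite -val_eqE /=; lia.
by have := @increasing_le a i ord_max inc lt; lia.
Qed.

(** The entries of the bi-infinite N-periodic extension of a; on increasing
    tuples it is a complete invariant of the arc. *)
Definition periodic a : set int := [set z | exists i q, z = a i + q * N%:Z].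

Lemma periodic_entry a i : periodic a (a i).
Proof. by exists i, 0; lia. Qed.

Lemma periodicD a z q : periodic a z -> periodic a (z + q * N%:Z).
Proof. by case=> i [p ->]; exists i, (p + q); lia. Qed.

Lemma periodic_next a i : periodic a (next a i).
Proof.
rewrite nextE /wrap; case: ifP => _; last by rewrite addr0; apply: periodic_entry.
by exists (ordS i), 1; lia.
Qed.

Lemma eqz_modE (m p : int) : (m == p %[mod N%:Z])%Z <-> exists q, m = p + q * N%:Z.
Proof.
rewrite eqz_mod_dvd; split=> [/dvdzP [q qE]|[q ->]].
  by exists q; rewrite -qE; lia.
by apply/dvdzP; exists q; lia.
Qed.

Lemma mem_arc a (x : 'I_N) : x \in arc_of N a <-> periodic a x.+1%:Z.
Proof.
rewrite inE; split=> [/existsP [i /eqz_modE [q ?]]|[i [q ?]]].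
  by exists i, q.
by apply/existsP; exists i; apply/eqz_modE; exists q.
Qed.

(** next a i is the successor of a_i among the entries of the periodic extension;
    it is thus determined by the arc. *)
Lemma next_le_periodic a i z :
  cyclic_increasing a -> periodic a z -> a i < z -> next a i <= z.
Proof.
move=> inc [j [q ->]] lt.
have [a0i ai0] := increasing_window i inc.
have [a0j aj0] := increasing_window j inc.
have nextle : next a i <= a ord0 + N%:Z.
  rewrite nextE /wrap; have [[-> ->]|[_ /negPf-> _]] := ordS_cases i.
    by rewrite eqxx.
  by have := increasing_window (ordS i) inc; lia.
have [q1|[q0|qn]] : 1 <= q \/ (q = 0 \/ q <= - 1) by lia.
- by nia.
- rewrite q0 mul0r addr0 in lt *.
  have ij : (i < j)%N.
    rewrite ltnNge leq_eqVlt; apply/negP => /orP [/eqP/val_inj ji|].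
      by rewrite ji in lt; lia.
    by move=> /(increasing_le inc); lia.
  have [[iE _]|[_ ne SE]] := ordS_cases i.
    by move: ij (ltn_ord j); rewrite iE /=; lia.
  rewrite nextE /wrap (negPf ne) addr0.
  have [->//|neS] := eqVneq (ordS i) j.
  have neS' : nat_of_ord (ordS i) != j by [].
  have lt2 : (ordS i < j)%N by rewrite SE in neS' *; lia.
  by have := increasing_le inc lt2; lia.
- by exfalso; nia.
Qed.

Lemma periodic_inj a i j q :
  cyclic_increasing a -> a i = a j + q * N%:Z -> i = j /\ q = 0.
Proof.
move=> inc E.
have [a0i ai0] := increasing_window i inc.
have [a0j aj0] := increasing_window j inc.
have q0 : q = 0 by nia.
split=> //; apply: val_inj => /=; rewrite q0 in E.
by case: (ltngtP i j) => // /(increasing_le inc); lia.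
Qed.

Lemma interlace_increasing x y :
  (forall i, x i < y i < next x i) ->
  cyclic_increasing x /\ cyclic_increasing y.
Proof.
move=> xy; split=> i; have := xy i; first by lia.
by have := xy (ordS i); rewrite !nextE; lia.
Qed.

Hypothesis N_gt0 : (0 < N)%N.

Lemma residue (z : int) : exists (x : 'I_N) q, x.+1%:Z = z + q * N%:Z.
Proof.
have N0 : N%:Z != 0 by lia.
have lt : (absz ((z - 1) %% N%:Z)%Z < N)%N.
  by have := modz_ge0 (z - 1) N0; have := @ltz_pmod (z - 1) N%:Z; lia.
exists (Ordinal lt), (- ((z - 1) %/ N%:Z)%Z) => /=.
have := divz_eq (z - 1) N%:Z; have := modz_ge0 (z - 1) N0; lia.
Qed.

Lemma arc_periodic a b : arc_of N a = arc_of N b <-> periodic a = periodic b.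
Proof.
split=> [eqab|eqp]; last first.
  apply/setP => x; apply/idP/idP => /mem_arc; first by rewrite eqp => /mem_arc.
  by rewrite -eqp => /mem_arc.
suff sub c e : arc_of N c = arc_of N e -> periodic c `<=` periodic e.
  by apply/seteqP; split; apply: sub.
move=> eqce z cz; have [x [q xE]] := residue z.
have : x \in arc_of N e by rewrite -eqce; apply/mem_arc; rewrite xE; apply: periodicD.
move=> /mem_arc; rewrite xE => /periodicD -/(_ (- q)).
by rewrite mulNr addrK.
Qed.

(** Each window [x i, next x i) contains exactly one entry of b and one of c,
    so the arc determines the lift. *)
Lemma lift_uniq x b (c : vec d) :
  (forall i, x i <= b i < next x i) -> (forall i, x i <= c i < next x i) ->
  arc_of N b = arc_of N c -> b = c.
Proof.
move=> xb xc /arc_periodic pbc.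
have inc : cyclic_increasing x by move=> i; have := xb i; lia.
apply: vec_ext => i.
have [j [q bE]] : periodic c (b i) by rewrite -pbc; apply: periodic_entry.
have [i0 i1] : x i <= b i /\ b i < next x i by have := xb i; lia.
have [j0 j1] : x j <= c j /\ c j < next x j by have := xc j; lia.
have pnext k p : periodic x (next x k + p * N%:Z) by apply/periodicD/periodic_next.
have pent k p : periodic x (x k + p * N%:Z) by apply/periodicD/periodic_entry.
have xij : x i = x j + q * N%:Z.
  case: (ltrgtP (x i) (x j + q * N%:Z)) => // lt.
    by have := next_le_periodic inc (pent j q) lt; lia.
  have lt' : x j < x i - q * N%:Z by lia.
  have := next_le_periodic inc _ lt'; rewrite -mulNr => /(_ (pent i (- q))); lia.
have [ij q0] := periodic_inj inc xij.
by rewrite bE q0 ij mul0r addr0.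
Qed.

(** Two tuples with the same periodic extension differ by a rotation, which
    carries every tuple interlaced with the one to a tuple interlaced with the
    other. *)
Lemma relift_left x y a :
  (forall i, x i < y i < next x i) -> cyclic_increasing a ->
  arc_of N a = arc_of N x ->
  exists b, arc_of N b = arc_of N y /\ forall i, a i < b i < next a i.
Proof.
move=> xy inca /arc_periodic pax; have [incx incy] := interlace_increasing xy.
have /fin_all_exists2 [f f1 f2] : forall i, exists2 jq : 'I_d.+1 * int,
    a i = x jq.1 + jq.2 * N%:Z & next a i = next x jq.1 + jq.2 * N%:Z.
  move=> i; have [j [q E]] : periodic x (a i).
    by rewrite -pax; apply: periodic_entry.
  exists (j, q) => //=; apply/eqP; rewrite eq_le; apply/andP; split.
    apply: next_le_periodic => //; last by have := incx j; lia.
    by rewrite pax; apply/periodicD/periodic_next.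
  rewrite -lerBrDr; apply: next_le_periodic => //; last by have := inca i; lia.
  by rewrite -mulNr; apply: periodicD; rewrite -pax; apply: periodic_next.
exists [ffun i => y (f i).1 + (f i).2 * N%:Z]; split; last first.
  by move=> i; rewrite ffunE f1 f2; have := xy (f i).1; lia.
apply/arc_periodic/seteqP; split=> z [i [q ->]].
  rewrite ffunE; exists (f i).1, ((f i).2 + q); lia.
have [j [p E]] : periodic a (x i) by rewrite pax; apply: periodic_entry.
have [] : i = (f j).1 /\ (f j).2 + p = 0 by apply: (periodic_inj incx); rewrite E f1; lia.
by move=> -> E2; exists j, (q + p); rewrite ffunE; nia.
Qed.

Definition rotate x : vec d := [ffun i => next x i].

Lemma arc_rotate x : arc_of N (rotate x) = arc_of N x.
Proof.
apply/arc_periodic/seteqP; split=> z [i [q ->]].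
  by rewrite ffunE; apply/periodicD/periodic_next.
have E : next x (ord_pred i) = x i + wrap (ord_pred i).
  by rewrite nextE ord_predK.
exists (ord_pred i), (q - (ord_pred i == ord_max)%:R); rewrite ffunE E /wrap.
by case: eqP => _; lia.
Qed.

Lemma interlace_rotate x y :
  (forall i, x i < y i < next x i) ->
  forall i, y i < rotate x i < next y i.
Proof.
by move=> xy i; rewrite ffunE; have := xy i; have := xy (ordS i); rewrite !nextE; lia.
Qed.

Lemma relift_right x y b :
  (forall i, x i < y i < next x i) -> cyclic_increasing b ->
  arc_of N b = arc_of N y ->
  exists a, arc_of N a = arc_of N x /\ forall i, a i < b i < next a i.
Proof.
move=> xy incb eqb.
have [c [cE bc]] := relift_left (interlace_rotate xy) incb eqb.
exists [ffun i => c (ord_pred i) - wrap (ord_pred i)]; split; last first.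
  move=> i; rewrite nextE !ffunE ordSK.
  by have := bc (ord_pred i); have := bc i; rewrite !nextE ord_predK; lia.
rewrite -(arc_rotate x) -cE; apply/arc_periodic/seteqP; split=> z [i [q ->]].
  rewrite ffunE; exists (ord_pred i), (q - (ord_pred i == ord_max)%:R).
  by rewrite /wrap; case: eqP => _; lia.
exists (ordS i), (q + (i == ord_max)%:R); rewrite ffunE ordSK.
by rewrite /wrap; case: eqP => _; lia.
Qed.

End CyclicLifts.

(** * Intertwining in terms of lifts *)

Section Intertwining.
Variables (d N : nat).
Implicit Types (a b x y : vec d) (X Y : {set 'I_N}) (i j : 'I_d.+1).

Local Notation next := (next_entry N).

Lemma arc_imset a (f : 'I_d.+1 -> 'I_N) (q : 'I_d.+1 -> int) :
  (forall i, a i = (f i).+1%:Z + q i * N%:Z) ->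
  arc_of N a = [set f i | i : 'I_d.+1]%SET.
Proof.
move=> aE; apply/setP => x; apply/idP/imsetP => [/mem_arc [i [p xE]]|[i _ ->]].
  exists i => //; apply: ord_inj.
  have := ltn_ord x; have := ltn_ord (f i); rewrite aE in xE.
  have [E|[E|E]] : q i + p = 0 \/ (1 <= q i + p \/ q i + p <= -1) by lia.
  - have xE' : x.+1%:Z = (f i).+1%:Z + (q i + p) * N%:Z by lia.
    by rewrite E in xE'; lia.
  - have : N%:Z <= (q i + p) * N%:Z by nia.
    by lia.
  - have : (q i + p) * N%:Z <= - N%:Z by nia.
    by lia.
by apply/mem_arc; exists i, (- q i); rewrite aE; lia.
Qed.

Lemma shift_down_inj : injective (@shift_down N).
Proof. by apply: imset_inj => x y; apply: ord_pred_inj. Qed.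

Hypothesis N_gt0 : (0 < N)%N.

Lemma arc_imsetE a : exists (f : 'I_d.+1 -> 'I_N) (q : 'I_d.+1 -> int),
  (forall i, a i = (f i).+1%:Z + q i * N%:Z) /\
  arc_of N a = [set f i | i : 'I_d.+1]%SET.
Proof.
have /fin_all_exists [f fE] : forall i, exists xq : 'I_N * int,
    a i = xq.1.+1%:Z + xq.2 * N%:Z.
  by move=> i; have [x [q E]] := residue N_gt0 (a i); exists (x, - q) => /=; lia.
exists (fst \o f), (snd \o f); split=> //.
exact: (@arc_imset a (fst \o f) (snd \o f)).
Qed.

Lemma shifted_posE s (x : 'I_N) : exists q,
  x.+1%:Z = (shifted_pos s x)%:Z + 1 - s%:Z + q * N%:Z.
Proof.
exists ((x + s) %/ N)%N%:Z; rewrite /shifted_pos.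
have := divn_eq (x + s) N; lia.
Qed.

Lemma shifted_pos_uniq s (x : 'I_N) (v q : int) :
  x.+1%:Z = v + 1 - s%:Z + q * N%:Z -> 0 <= v < N%:Z ->
  (shifted_pos s x)%:Z = v.
Proof.
move=> xE vN; have [p pE] := shifted_posE s x.
have lt : (shifted_pos s x < N)%N by rewrite /shifted_pos ltn_mod.
have [E|[E|E]] : p = q \/ (p + 1 <= q \/ q + 1 <= p) by lia.
- by rewrite E in pE; lia.
- by nia.
- by nia.
Qed.

Lemma intertwiningP X Y :
  intertwining d X Y <->
  exists x y, [/\ X = arc_of N x, Y = arc_of N y & forall i, x i < y i < next x i].
Proof.
split=> [[s [f [g [-> -> fg gf]]]]|[x [y [-> -> xy]]]].
  pose lift (h : 'I_d.+1 -> 'I_N) : vec d :=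
    [ffun i => (shifted_pos s (h i))%:Z + 1 - s%:Z].
  have liftE h : [set h i | i : 'I_d.+1]%SET = arc_of N (lift h).
    have /fin_all_exists [q qE] i := shifted_posE s (h i).
    by apply/esym/(@arc_imset _ _ (fun i => - q i)) => i; rewrite ffunE qE; lia.
  exists (lift f), (lift g); split=> // i; rewrite nextE !ffunE /wrap.
  have := fg i; have := ltn_pmod (g i + s) N_gt0.
  have [[-> ->]|[_ /negPf-> SE]] := ordS_cases i; rewrite ?eqxx /shifted_pos.
    lia.
  by have := gf i (ordS i) SE; rewrite /shifted_pos; lia.
have [f [p [fE ->]]] := arc_imsetE x; have [g [q [gE ->]]] := arc_imsetE y.
have [incx incy] := interlace_increasing xy.
have N0 : N%:Z != 0 by lia.
(* The cyclic shift that starts at x_0. *)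
pose s := absz ((1 - x ord0) %% N%:Z)%Z.
pose r := ((1 - x ord0) %/ N%:Z)%Z.
have sE : s%:Z = 1 - x ord0 - r * N%:Z.
  have := divz_eq (1 - x ord0) N%:Z; have := modz_ge0 (1 - x ord0) N0.
  by rewrite /s /r; lia.
have posf i : (shifted_pos s (f i))%:Z = x i - x ord0.
  apply: (@shifted_pos_uniq _ _ _ (- p i - r)); first by rewrite sE fE; lia.
  by have := increasing_window i incx; lia.
have posg i : (shifted_pos s (g i))%:Z = y i - x ord0.
  apply: (@shifted_pos_uniq _ _ _ (- q i - r)); first by rewrite sE gE; lia.
  have := increasing_window i incx; have := xy i.
  rewrite nextE /wrap; case: (ordS_cases i) => [[-> ->]|[_ /negPf-> _]].
    by rewrite eqxx; lia.
  by have := increasing_window (ordS i) incx; lia.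
exists s, f, g; split=> // [i|i j jE].
  by have := xy i; have := posf i; have := posg i; lia.
have ji : j = ordS i.
  apply: ord_inj; have [[iE _]|[_ _ ->//]] := ordS_cases i.
  by move: (ltn_ord j); rewrite jE iE /=; lia.
have := xy i; rewrite nextE /wrap -ji.
case: eqP => [iE|_]; first by move: (ltn_ord j); rewrite jE iE /=; lia.
by have := posf j; have := posg i; lia.
Qed.

Lemma intertwining_sym X Y : intertwining d X Y -> intertwining d Y X.
Proof.
move=> /intertwiningP [x [y [-> -> xy]]]; apply/intertwiningP.
by exists y, (rotate N x); rewrite arc_rotate //; split=> //; apply: interlace_rotate.
Qed.

Lemma card_arc a : cyclic_increasing N a -> #|arc_of N a| = d.+1.
Proof.
move=> inc; have [f [q [fE ->]]] := arc_imsetE a.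
rewrite card_imset ?card_ord // => i j fij.
have E : a i = a j + (q i - q j) * N%:Z by rewrite !fE fij; lia.
by have [] := periodic_inj inc E.
Qed.

Lemma arc_of_sub1 a : shift_down (arc_of N a) = arc_of N (a - ones d).
Proof.
have [f [q [fE ->]]] := arc_imsetE a.
have predE (x : 'I_N) : exists p, (ord_pred x).+1%:Z = x%:Z + p * N%:Z.
  case: N N_gt0 x => // M _ x /=.
  have [->|x0] := posnP x; first by exists 1; rewrite add0n modn_small //=; lia.
  exists 0; have -> : (x + M.+1).-1 = (x.-1 + M.+1)%N by lia.
  by rewrite modnDr modn_small; have := ltn_ord x; lia.
have /fin_all_exists [p pE] i := predE (f i).
rewrite (@arc_imset _ (fun i => ord_pred (f i)) (fun i => q i - p i)).
  rewrite /shift_down -imset_comp.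
  by apply/setP => x; apply/imsetP/imsetP => -[i _ ->]; exists i.
by move=> i; rewrite !vecE fE pE; lia.
Qed.

(** X - 1 and Y intertwine: the relation underlying the arrows of the quiver
    of a triangulation. *)
Definition precedes X Y := intertwining d (shift_down X) Y.

Lemma precedesI x y :
  (forall i, x i <= y i <= next x i - 2) -> precedes (arc_of N x) (arc_of N y).
Proof.
move=> xy; apply/intertwiningP; exists (x - ones d), y.
by split; [exact: arc_of_sub1 | by [] |] => i; have := xy i; rewrite !nextE !vecE; lia.
Qed.

(** A given lift of one of the two arcs can be kept; only the other one is lifted. *)
Lemma precedes_liftr x Y : cyclic_increasing N x -> precedes (arc_of N x) Y ->
  exists y, Y = arc_of N y /\ forall i, x i <= y i <= next x i - 2.
Proof.
move=> incx; rewrite /precedes arc_of_sub1 => /intertwiningP [x' [y' [E -> xy']]].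
have inc : cyclic_increasing N (x - ones d).
  by move=> i; have := incx i; rewrite !nextE !vecE; lia.
have [y [<- xy]] := relift_left N_gt0 xy' inc E.
by exists y; split=> // i; have := xy i; rewrite !nextE !vecE; lia.
Qed.

Lemma precedes_liftl X y : cyclic_increasing N y -> precedes X (arc_of N y) ->
  exists x, X = arc_of N x /\ forall i, x i <= y i <= next x i - 2.
Proof.
move=> incy /intertwiningP [x' [y' [X'E yE xy']]].
have [x [xE xy]] := relift_right N_gt0 xy' incy yE.
exists (x + ones d); split.
  by apply: shift_down_inj; rewrite arc_of_sub1 X'E -xE addrK.
by move=> i; have := xy i; rewrite !nextE !vecE; lia.
Qed.

End Intertwining.

(** * Weights on the moment curve *)

Section Moments.
Variables (R : realType) (d N : nat) (t : 'I_N -> R).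
Hypothesis t_inc : forall i j : 'I_N, (i < j)%N -> t i < t j.
Implicit Types (i j z : 'I_N) (X Y Z : {set 'I_N}) (p q : {poly R})
  (u w : 'I_N -> R) (v : 'rV[R]_(2 * d)).

Local Notation m := (2 * d).+1.
Local Notation point i := (moment_point d (t i)).
Local Notation hull := (hull t).

Lemma t_inj : injective t.
Proof.
move=> i j tij; apply: ord_inj; case: (ltngtP i j) => // /t_inc; rewrite tij ltxx //.
Qed.

Definition moment w p : R := \sum_i w i * p.[t i].

(** The weights u and w represent the same vector in homogeneous coordinates on
    the moment curve. *)
Definition same_moments u w := forall p, (size p <= m)%N -> moment u p = moment w p.

Definition supported w Z := forall i, i \notin Z -> w i = 0.

Lemma momentD u w p : moment (fun i => u i + w i) p = moment u p + moment w p.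
Proof. by rewrite /moment -big_split; apply: eq_bigr => i _; rewrite mulrDl. Qed.

Lemma momentZ c w p : moment (fun i => c * w i) p = c * moment w p.
Proof. by rewrite /moment mulr_sumr; apply: eq_bigr => i _; rewrite mulrA. Qed.

Lemma moment_supported w Z p :
  supported w Z -> moment w p = \sum_(i in Z) w i * p.[t i].
Proof.
move=> wZ; rewrite /moment [RHS]big_mkcond; apply: eq_bigr => i _.
by case: ifPn => // /wZ ->; rewrite mul0r.
Qed.

Definition lagrange Z i : {poly R} :=
  \prod_(z in Z :\ i) ((t i - t z)^-1 *: ('X - (t z)%:P)).

Lemma size_prodXsubC Z : size (\prod_(z in Z) ('X - (t z)%:P)) = #|Z|.+1.
Proof.
rewrite -big_enum /= -(big_map t xpredT (fun x => 'X - x%:P)).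
by rewrite size_prod_XsubC size_map -cardE.
Qed.

Lemma size_lagrange Z i : i \in Z -> (size (lagrange Z i) <= #|Z|)%N.
Proof.
move=> iZ; rewrite /lagrange scaler_prod (leq_trans (size_scale_leq _ _)) //.
by rewrite size_prodXsubC (cardsD1 i Z) iZ.
Qed.

Lemma lagrangeE Z i j : i \in Z -> j \in Z -> (lagrange Z i).[t j] = (i == j)%:R.
Proof.
move=> iZ jZ; rewrite /lagrange horner_prod; have [<-|ne] := eqVneq i j.
  rewrite big1 // => z; rewrite !inE => /andP [zi _].
  by rewrite !hornerE mulVf // subr_eq0 inj_eq ?[i == z]eq_sym //; apply: t_inj.
by rewrite (bigD1 j) ?inE ?jZ 1?eq_sym ?ne //= !hornerE subrr mulr0 mul0r.
Qed.

Lemma interpolation Z p : (size p <= #|Z|)%N ->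
  p = \sum_(i in Z) p.[t i] *: lagrange Z i.
Proof.
move=> sp; apply/eqP; rewrite -subr_eq0; apply: contraT => nz.
set q := _ - _ in nz.
have sq : (size q <= #|Z|)%N.
  rewrite (leq_trans (size_polyD _ _)) // geq_max sp size_polyN.
  apply: (leq_trans (size_sum _ _ _)); apply/bigmax_leqP => i iZ.
  by rewrite (leq_trans (size_scale_leq _ _)) // size_lagrange.
suff : (size [seq t i | i <- enum Z] < size q)%N.
  by rewrite size_map -cardE ltnNge sq.
apply: max_poly_roots => //; last by rewrite map_inj_uniq ?enum_uniq //; apply: t_inj.
apply/allP => x /mapP [i]; rewrite mem_enum => iZ ->.
rewrite rootE /q !hornerE horner_sum (bigD1 i) //= big1 => [|j /andP [jZ ji]].
  by rewrite !hornerE lagrangeE // eqxx mulr1 ?addr0 subrr.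
by rewrite !hornerE lagrangeE // (negPf ji) mulr0.
Qed.

(** Any 2d + 1 points of the moment curve are a basis in homogeneous coordinates. *)
Lemma transfer_weights u Z : #|Z| = m -> exists2 w, supported w Z & same_moments w u.
Proof.
move=> cZ; exists (fun i => if i \in Z then moment u (lagrange Z i) else 0).
  by move=> i /negPf->.
move=> p sp; rewrite (@moment_supported _ Z) => [|i /negPf-> //].
rewrite [in RHS](interpolation (Z := Z) (p := p)) ?cZ //.
rewrite (eq_bigr (fun i => moment u (lagrange Z i) * p.[t i])) => [|i -> //].
rewrite /moment.
under eq_bigr => i _ do rewrite mulr_suml.
rewrite exchange_big /=; apply: eq_bigr => l _.
rewrite horner_sum mulr_sumr; apply: eq_bigr => i _.
by rewrite hornerZ; ring.
Qed.

(** The linear form on polynomials of degree at most 2d with 1 |-> 1 and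
    X^(j+1) |-> v_j; at a point of the moment curve it is the evaluation. *)
Definition coords v p : R := p`_0 + \sum_(j < 2 * d) p`_j.+1 * v 0 j.

Definition represents w v := forall p, (size p <= m)%N -> moment w p = coords v p.

Lemma coordsD v p q : coords v (p + q) = coords v p + coords v q.
Proof.
rewrite /coords coefD addrACA -big_split /=; congr (_ + _).
by apply: eq_bigr => j _; rewrite coefD mulrDl.
Qed.

Lemma coordsZ v c p : coords v (c *: p) = c * coords v p.
Proof.
rewrite /coords coefZ mulrDr mulr_sumr; congr (_ + _).
by apply: eq_bigr => j _; rewrite coefZ mulrA.
Qed.

Lemma coords0 v : coords v 0 = 0.
Proof. by rewrite -[0 in LHS](scale0r 0) coordsZ mul0r. Qed.

Lemma coords_sum v (I : finType) (P : pred I) (F : I -> {poly R}) :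
  coords v (\sum_(i | P i) F i) = \sum_(i | P i) coords v (F i).
Proof. by apply: (big_morph (coords v) (coordsD v) (coords0 v)). Qed.

Lemma coords1 v : coords v 1 = 1.
Proof. by rewrite /coords coef1 big1 ?addr0 // => j _; rewrite coef1 mul0r. Qed.

Lemma coordsXn v (j : 'I_(2 * d)) : coords v 'X^(j.+1) = v 0 j.
Proof.
rewrite /coords coefXn add0r (bigD1 j) //= big1 => [|l lj].
  by rewrite coefXn eqxx mul1r addr0.
by rewrite coefXn eqSS -[_ == _]/(l == j) (negPf lj) mul0r.
Qed.

Lemma represents_sum w v :
  represents w v <-> \sum_i w i = 1 /\ v = \sum_i w i *: point i.
Proof.
split=> [wv|[w1 ->] p sp].
  split.
    have := wv 1; rewrite coords1 size_poly1 => <- //.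
    by apply: eq_bigr => i _; rewrite hornerE mulr1.
  apply/rowP => j; rewrite -coordsXn -wv ?size_polyXn ?ltnS //.
  by rewrite summxE; apply: eq_bigr => i _; rewrite !mxE hornerXn.
rewrite /moment /coords.
under eq_bigr => i _.
  rewrite (@horner_coef_wide _ m) // big_ord_recl expr0 mulr1 mulrDr.
  over.
rewrite big_split /= -mulr_suml w1 mul1r; congr (_ + _).
under eq_bigr => i _ do rewrite mulr_sumr.
rewrite exchange_big /=; apply: eq_bigr => j _.
rewrite summxE mulr_sumr; apply: eq_bigr => i _.
by rewrite !mxE mulrCA /bump /= add1n.
Qed.

Lemma hullP X v :
  hull X v <-> exists w, [/\ forall i, 0 <= w i, supported w X & represents w v].
Proof.
split=> [[w [w0 w1 ->]]|[w [w0 wX /represents_sum [w1 ->]]]].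
  exists (fun i => if i \in X then w i else 0); split=> [i|i /negPf->//|].
    by case: ifP.
  apply/represents_sum; rewrite -big_mkcond w1; split=> //.
  by rewrite big_mkcond; apply: eq_bigr => i _; case: ifP; rewrite ?scale0r.
exists w; split=> //.
  rewrite -w1 [LHS]big_mkcond; apply: eq_bigr => i _.
  by case: ifPn => // /wX ->.
rewrite [RHS]big_mkcond; apply: eq_bigr => i _.
by case: ifPn => // /wX ->; rewrite scale0r.
Qed.

Lemma coords_continuous p : continuous (coords ^~ p).
Proof.
move=> v; rewrite /coords.
apply: (@continuousD _ _ _ (fun=> p`_0)); first exact: cst_continuous.
suff sum_cont (s : seq 'I_(2 * d)) :
    continuous (fun x : 'rV[R]_(2 * d) => \sum_(j <- s) p`_j.+1 * x 0 j).
  exact: sum_cont.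
elim: s => [|j s IHs].
  under eq_fun do rewrite big_nil.
  exact: cst_continuous.
under eq_fun do rewrite big_cons.
move=> x; apply: (@continuousD _ _ _ (fun x : 'rV[R]_(2 * d) => _)); last exact: IHs.
apply: (@continuousM _ _ (fun=> p`_j.+1)); first exact: cst_continuous.
exact: coord_continuous.
Qed.

(** The barycentric coordinates with respect to X are the values of [coords] on the
    Lagrange polynomials of X, hence they stay positive near v. *)
Lemma interior_hull X w v : #|X| = m -> supported w X ->
  (forall i, i \in X -> 0 < w i) -> represents w v -> interior (hull X) v.
Proof.
move=> cX wX w_gt0 wv.
have wE i : i \in X -> coords v (lagrange X i) = w i.
  move=> iX; rewrite -wv -?cX ?size_lagrange // (moment_supported _ wX).
  rewrite (bigD1 i) //= big1 => [|j /andP [jX ji]].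
    by rewrite lagrangeE // eqxx mulr1 addr0.
  by rewrite lagrangeE // [i == j]eq_sym (negPf ji) mulr0.
have : \forall x \near v, forall i, i \in X -> 0 < coords x (lagrange X i).
  apply: (@filter_forall _ _
    (fun i x => i \in X -> 0 < coords x (lagrange X i)) (nbhs v)) => i.
  case: (boolP (i \in X)) => [iX|_]; last exact: nearW.
  have := @cvgr_gt _ _ _ _ _ _ (@coords_continuous (lagrange X i) v) 0.
  by rewrite wE // w_gt0 // => /(_ _ isT); apply: filterS => x x_gt0 _.
apply: filterS => x x_gt0; apply/hullP.
exists (fun i => if i \in X then coords x (lagrange X i) else 0); split.
- by move=> i; case: ifP => // /x_gt0/ltW.
- by move=> i /negPf->.
move=> p sp; rewrite (@moment_supported _ X) => [|i /negPf->//].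
rewrite [in RHS](interpolation (Z := X) (p := p)) ?cX // coords_sum.
by apply: eq_bigr => i iX; rewrite iX coordsZ mulrC.
Qed.

End Moments.

(** * Crossing simplices *)

Section Crossing.
Variables (R : realType) (d N : nat) (t : 'I_N -> R).
Hypothesis t_inc : forall i j : 'I_N, (i < j)%N -> t i < t j.
Hypothesis N_gt0 : (0 < N)%N.
Implicit Types (i j z : 'I_N) (U X Y Z A B : {set 'I_N}) (p q : {poly R})
  (u w : 'I_N -> R) (v : 'rV[R]_(2 * d)).

Local Notation m := (2 * d).+1.

Lemma moment0 p : moment t (fun=> 0) p = 0.
Proof. by rewrite /moment big1 // => i _; rewrite mul0r. Qed.

(** Test a dependence of 2d + 2 points against the polynomial vanishing at all of
    them but i and j. The product of its values at i and j has 2d factors of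
    constant sign, hence is positive, even when all the other points lie between
    i and j. *)
Lemma adjacent_signs U w i j : #|U| = m.+1 -> supported w U ->
  same_moments d t w (fun=> 0) -> i \in U -> j \in U -> i != j ->
  (forall z, z \in U -> z != i -> z != j -> 0 < (t i - t z) * (t j - t z)) \/
  (forall z, z \in U -> z != i -> z != j -> (t i - t z) * (t j - t z) < 0) ->
  exists2 c, 0 < c & w j = - c * w i.
Proof.
move=> cU wU w0 iU jU ij sgn.
pose V := (U :\ i) :\ j; pose Q : {poly R} := \prod_(z in V) ('X - (t z)%:P).
have cV : #|V| = (2 * d)%N.
  have cUi : #|U :\ i| = m by have := cardsD1 i U; rewrite cU iU add1n => -[->].
  have jUi : j \in U :\ i by rewrite in_setD1 eq_sym ij.
  by have := cardsD1 j (U :\ i); rewrite cUi jUi add1n => -[->].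
have sQ : (size Q <= m)%N by rewrite size_prodXsubC cV.
have Q_mul : 0 < Q.[t i] * Q.[t j].
  rewrite /Q !horner_prod -big_split /=.
  under eq_bigr => z _ do rewrite !hornerE.
  have Vsub z : z \in V -> [/\ z \in U, z != i & z != j].
    by rewrite !inE => /andP [zj /andP [zi zU]].
  case: sgn => sgn; first by apply: prodr_gt0 => z /Vsub [] *; apply: sgn.
  rewrite (eq_bigr (fun z => - (- ((t i - t z) * (t j - t z))))); last first.
    by move=> z _; rewrite opprK.
  rewrite prodrN cV mul2n -signr_odd odd_double expr0 mul1r.
  by apply: prodr_gt0 => z /Vsub [] *; rewrite oppr_gt0; apply: sgn.
have eq0 : w i * Q.[t i] + w j * Q.[t j] = 0.
  have := w0 Q sQ; rewrite moment0 (moment_supported t Q wU) => <-.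
  rewrite (bigD1 i) //= (bigD1 j) /= ?jU 1?eq_sym ?ij // big1 ?addr0 // => z.
  move=> /andP [/andP [zU zi] zj]; rewrite /Q horner_prod (bigD1 z) /=.
    by rewrite hornerXsubC subrr !(mul0r, mulr0).
  by rewrite !inE zi zj.
have Qj : Q.[t j] != 0 by apply: contraTneq Q_mul => ->; rewrite mulr0 ltxx.
exists (Q.[t i] / Q.[t j]).
  have -> : Q.[t i] / Q.[t j] = (Q.[t i] * Q.[t j]) / Q.[t j] ^+ 2 by field.
  by rewrite divr_gt0 // exprn_even_gt0.
by apply: (mulIf Qj); rewrite mulNr mulrAC -mulNr divfK //; lra.
Qed.

(** The starting point of the chain c in the cyclic order on the labels does not
    matter: where c wraps around from the last label to the first, all 2d other
    points lie between two consecutive ones, and [adjacent_signs] still applies.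
    The dependence is normalised to be 1 at the first point of the chain. *)
Lemma alternating_chain (c : vec (2 * d).+1) : cyclic_increasing N c ->
  exists w, [/\ supported w (arc_of N c), same_moments d t w (fun=> 0) &
    forall (l : 'I_(2 * d).+2) z (r : int), c l = z.+1%:Z + r * N%:Z ->
      if odd l then w z < 0 else 0 < w z].
Proof.
move=> incc; have [f [q [cE UE]]] := arc_imsetE N_gt0 c.
set U := arc_of N c in UE *.
have cU : #|U| = m.+1 by rewrite /U card_arc.
have fU l : f l \in U by rewrite UE imset_f.
have f_inj l l' : f l = f l' -> l = l'.
  move=> E; have cll : c l = c l' + (q l - q l') * N%:Z by rewrite !cE E; lia.
  by have [] := periodic_inj incc cll.
have cZ : #|U :\ f ord0| = m.
  by have := cardsD1 (f ord0) U; rewrite cU fU add1n => -[/esym].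
have [w0 w0Z w0m] := transfer_weights t_inc (fun z => - (z == f ord0)%:R) cZ.
pose w z := w0 z + (z == f ord0)%:R.
have wU : supported w U.
  move=> z zU; rewrite /w w0Z; last by rewrite in_setD1 (negPf zU) andbF.
  by case: eqP zU => [->|_ _]; rewrite ?fU // add0r.
have wm : same_moments d t w (fun=> 0).
  move=> p sp; rewrite momentD w0m // -momentD moment0.
  by rewrite /moment big1 // => l _; rewrite addNr mul0r.
have sgn (k : nat) (lt : (k < (2 * d).+2)%N) :
    if odd k then w (f (Ordinal lt)) < 0 else 0 < w (f (Ordinal lt)).
  elim: k lt => [|k IHk] lt.
    have -> : Ordinal lt = ord0 by apply: ord_inj.
    by rewrite /w w0Z ?in_setD1 ?eqxx //= add0r ltr01.
  have ltk : (k < (2 * d).+2)%N by lia.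
  have := IHk ltk; set i := f (Ordinal ltk); set j := f (Ordinal lt).
  have kE : ordS (Ordinal ltk) = Ordinal lt.
    by apply: ord_inj => /=; rewrite modn_small.
  have nextk : next_entry N c (Ordinal ltk) = c (Ordinal lt).
    rewrite nextE kE /wrap; case: eqP => [/(congr1 val) /=|]; lia.
  have ij : i != j by apply/eqP => /f_inj /(congr1 val) /=; lia.
  have [|e e_gt0 ->] := adjacent_signs cU wU wm (fU (Ordinal ltk)) (fU (Ordinal lt)) ij.
  - have ci := cE (Ordinal ltk); have cj := cE (Ordinal lt).
    rewrite -/i -/j in ci cj.
    have clt : c (Ordinal ltk) < c (Ordinal lt) by rewrite -nextk; apply: incc.
    have [wi1 wi2] := increasing_window (Ordinal ltk) incc.
    have [wj1 wj2] := increasing_window (Ordinal lt) incc.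
    have out z (r : int) : z \in U -> z.+1%:Z + r * N%:Z <= c (Ordinal ltk) \/
                        c (Ordinal lt) <= z.+1%:Z + r * N%:Z.
      move=> zU; have [|gt] := lerP (z.+1%:Z + r * N%:Z) (c (Ordinal ltk)); first by left.
      right; rewrite -nextk; apply: next_le_periodic => //.
      by apply: periodicD; apply/mem_arc.
    have ltt z z' : (z < z')%N -> t z < t z' by apply: t_inc.
    (* In the second case the chain wraps around between i and j. *)
    have [qE|qE] : q (Ordinal lt) = q (Ordinal ltk) \/
                   q (Ordinal lt) = q (Ordinal ltk) + 1.
      have := ltn_ord i; have := ltn_ord j => ltj lti.
      have rE : (q (Ordinal lt) - q (Ordinal ltk)) * N%:Z =
        c (Ordinal lt) - c (Ordinal ltk) + i%:Z - j%:Z by lia.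
      have [r1|[r2|r3]] : q (Ordinal lt) - q (Ordinal ltk) <= -1 \/
         (2 <= q (Ordinal lt) - q (Ordinal ltk) \/
          0 <= q (Ordinal lt) - q (Ordinal ltk) <= 1) by lia.
      - by have : (q (Ordinal lt) - q (Ordinal ltk)) * N%:Z <= - N%:Z; [nia|lia].
      - by have : 2 * N%:Z <= (q (Ordinal lt) - q (Ordinal ltk)) * N%:Z; [nia|lia].
      - by lia.
    + left => z zU zi zj; rewrite -/i -/j.
      have ziN : nat_of_ord z != i by []; have zjN : nat_of_ord z != j by [].
      rewrite qE in cj; have [le|ge] := out z (q (Ordinal ltk)) zU.
        by rewrite mulr_gt0 // subr_gt0; apply: ltt; lia.
      by rewrite -mulrNN mulr_gt0 // oppr_gt0 subr_lt0; apply: ltt; lia.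
    + right => z zU zi zj; rewrite -/i -/j.
      have ziN : nat_of_ord z != i by []; have zjN : nat_of_ord z != j by [].
      have := ltn_ord z; have := ltn_ord i; have := ltn_ord j; rewrite qE in cj.
      have := out z (q (Ordinal ltk)) zU; have := out z (q (Ordinal ltk) + 1) zU.
      move=> o1 o2 *; rewrite pmulr_rlt0 ?subr_lt0 ?subr_gt0; apply: ltt; lia.
  - by rewrite /=; case: (odd k) => /= wi; rewrite mulNr ?oppr_lt0 ?oppr_gt0;
      [rewrite pmulr_rlt0 | rewrite mulr_gt0].
exists w; split=> // l z r clE.
have zE : z = f l.
  have := UE; have : z \in U.
    by apply/mem_arc; exists l, (- r); rewrite clE; lia.
  rewrite UE => /imsetP [l' _ zl'] _.
  have E : c l = c l' + (r - q l') * N%:Z by rewrite clE cE zl'; lia.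
  by have [-> _] := periodic_inj incc E.
by rewrite zE; case: l {clE zE} => k lt; apply: sgn.
Qed.

(** Merge x and y into the chain x_0 < y_0 < x_1 < y_1 < .. of length 2d + 2. *)
Lemma alternating_weights (x y : vec d) :
  (forall l, x l < y l < next_entry N x l) ->
  exists w, [/\ supported w (arc_of N x :|: arc_of N y), same_moments d t w (fun=> 0),
    forall z, z \in arc_of N x -> 0 < w z & forall z, z \in arc_of N y -> w z < 0].
Proof.
move=> xy; have [incx incy] := interlace_increasing xy.
pose c : vec (2 * d).+1 := [ffun l : 'I_(2 * d).+2 =>
  if odd l then y (inord l./2) else x (inord l./2)].
have half_lt (l : 'I_(2 * d).+2) : (l./2 < d.+1)%N by have := ltn_ord l; lia.
have incc : cyclic_increasing N c.
  move=> l; rewrite nextE /wrap; have [[-> ->]|[lt /negPf-> SE]] := ordS_cases l.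
    rewrite eqxx !ffunE /= mul2n odd_double /= uphalf_double.
    have -> : inord d = @ord_max d by apply: ord_inj; rewrite inordK.
    have -> : inord 0 = @ord0 d by apply: ord_inj; rewrite inordK.
    have := xy ord_max; rewrite nextE /wrap eqxx.
    by have [[_ ->]|[]] := ordS_cases (@ord_max d); rewrite ?ltnn //; lia.
  rewrite addr0 !ffunE SE /=; case: ifP => ol /=.
    have := xy (inord l./2); rewrite nextE /wrap.
    have [[E _]|[lt2 /negPf-> S2]] := ordS_cases (inord l./2 : 'I_d.+1).
      by have := congr1 (@nat_of_ord _) E; rewrite /= inordK //; lia.
    suff -> : inord (uphalf l) = ordS (inord l./2 : 'I_d.+1) by lia.
    by apply: ord_inj; rewrite S2 !inordK //; have := half_lt l;
      rewrite ?inordK // in lt2 *; lia.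
  suff -> : uphalf l = l./2 by have := xy (inord l./2); lia.
  by lia.
have [w [wc w0 sgn]] := alternating_chain incc.
have cx (i : 'I_d.+1) : exists2 l : 'I_(2 * d).+2, ~~ odd l & c l = x i.
  have lt : (i.*2 < (2 * d).+2)%N by have := ltn_ord i; lia.
  exists (Ordinal lt); rewrite ?ffunE /= odd_double //= doubleK.
  by congr (x _); apply: ord_inj; rewrite inordK.
have cy (i : 'I_d.+1) : exists2 l : 'I_(2 * d).+2, odd l & c l = y i.
  have lt : (i.*2.+1 < (2 * d).+2)%N by have := ltn_ord i; lia.
  exists (Ordinal lt); rewrite ?ffunE /= odd_double //= uphalf_double.
  by congr (y _); apply: ord_inj; rewrite inordK.
exists w; split=> // z.
- rewrite inE negb_or => /andP [zx zy]; apply: wc; apply/negP => /mem_arc [l [q zE]].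
  move: zE; rewrite ffunE; case: ifP => _ zE.
    by move/negP: zy; apply; apply/mem_arc; exists (inord l./2), q.
  by move/negP: zx; apply; apply/mem_arc; exists (inord l./2), q.
- move=> /mem_arc [i [q zE]]; have [l /negPf ol cl] := cx i.
  by have := sgn l z (- q); rewrite ol; apply; rewrite cl; lia.
- move=> /mem_arc [i [q zE]]; have [l ol cl] := cy i.
  by have := sgn l z (- q); rewrite ol; apply; rewrite cl; lia.
Qed.

Lemma exists_scale (U : {set 'I_N}) w (c : 'I_N -> R) : (forall z, z \in U -> w z != 0) ->
  exists M, forall z, z \in U -> `|c z| < M * `|w z|.
Proof.
move=> w_neq0; exists (1 + \sum_(z in U) `|c z| / `|w z|) => z zU.
have wz : 0 < `|w z| by rewrite normr_gt0 w_neq0.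
rewrite -ltr_pdivrMr // (bigD1 z) //= addrCA -subr_gt0 addrAC subrr add0r.
by apply: ltr_pwDl => //; apply: sumr_ge0 => i _; rewrite divr_ge0.
Qed.

(** At the crossing point of the simplices on A and B, the cone of X is invariant
    under translations along A and that of Y under translations along B; since
    these directions span the space, X and Y share interior points. *)
Lemma interiors_meet X Y A B : #|X| = m -> #|Y| = m -> A \subset X -> B \subset Y ->
  intertwining d A B ->
  interior (hull t X) `&` interior (hull (d := d) t Y) !=set0.
Proof.
move=> cX cY AX BY /(intertwiningP d N_gt0) [x [y [AE BE xy]]].
have [w [wU w0 wA wB]] := alternating_weights xy; rewrite -AE -BE in wU wA wB.
have [incx incy] := interlace_increasing xy.
have disj z : z \in A -> z \in B -> False.
  by move=> /wA zA /wB zB; have := lt_trans zA zB; rewrite ltxx.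
have [z0 z0A] : exists z0, z0 \in A.
  by apply/set0Pn; rewrite -card_gt0 AE card_arc.
have cU : #|A :|: B| = m.+1.
  rewrite cardsU (_ : A :&: B = finset.set0) ?cards0 ?subn0.
    by rewrite AE BE !card_arc //; lia.
  by apply/setP => z; rewrite !inE; apply/negP => /andP [/disj zA /zA].
have cZ : #|(A :|: B) :\ z0| = m.
  by have := cardsD1 z0 (A :|: B); rewrite cU finset.in_setU z0A add1n => -[/esym].
pose u z : R := (z \in X :\: A)%:R - (z \in Y :\: B)%:R.
have [c cZs cu] := transfer_weights t_inc u cZ.
have cs z : z \notin A :|: B -> c z = 0.
  by move=> zAB; apply: cZs; rewrite in_setD1 (negPf zAB) andbF.
(* u = lam - mu outside A and B; c moves it onto A and B without changing the
   moments, and M is large enough to keep all the weights positive there. *)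
have [M MP] : exists M, forall z, z \in A :|: B -> `|c z| < M * `|w z|.
  apply: exists_scale => z; rewrite inE => /orP [/wA|/wB]; first by case: ltrgtP.
  by case: ltrgtP.
pose lam z := if z \in A then M * w z - c z else (z \in X)%:R.
pose mu z := if z \in B then c z - M * w z else (z \in Y)%:R.
have lam_gt0 z : z \in X -> 0 < lam z.
  rewrite /lam => zX; case: ifP => [zA|_]; last by rewrite zX ltr01.
  have zU : z \in A :|: B by rewrite inE zA.
  have := MP z zU; rewrite (gtr0_norm (wA z zA)) ltr_norml; lra.
have mu_gt0 z : z \in Y -> 0 < mu z.
  rewrite /mu => zY; case: ifP => [zB|_]; last by rewrite zY ltr01.
  have zU : z \in A :|: B by rewrite inE zB orbT.
  have := MP z zU; rewrite (ltr0_norm (wB z zB)) ltr_norml; lra.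
have lamX : supported lam X.
  move=> z zX; rewrite /lam (negPf zX).
  by case: ifP => // /(fintype.subsetP AX); rewrite (negPf zX).
have muY : supported mu Y.
  move=> z zY; rewrite /mu (negPf zY).
  by case: ifP => // /(fintype.subsetP BY); rewrite (negPf zY).
have lammu : same_moments d t lam mu.
  move=> p sp; have := w0 p sp; have := cu p sp; rewrite moment0 /moment => E1 E2.
  apply/eqP; rewrite -subr_eq0 -sumrB.
  rewrite (eq_bigr (fun z => M * (w z * p.[t z]) + (u z * p.[t z] - c z * p.[t z]))).
    by rewrite big_split /= -mulr_sumr E2 sumrB E1 mulr0 subrr addr0.
  move=> z _; rewrite -!mulrBl mulrA -mulrDl; congr (_ * _).
  rewrite /lam /mu /u !finset.in_setD.
  case: (boolP (z \in A)) => zA; case: (boolP (z \in B)) => zB /=.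
  - by case: (disj z).
  - by lra.
  - by lra.
  - by rewrite cs ?wU ?inE ?negb_or ?zA ?zB //; lra.
pose s := \sum_z lam z.
have s_gt0 : 0 < s.
  rewrite /s (bigD1 z0) //=; apply: ltr_pwDl; first exact/lam_gt0/(fintype.subsetP AX).
  by apply: sumr_ge0 => z _; case: (boolP (z \in X)) => [/lam_gt0/ltW//|/lamX->].
pose v := \sum_z (s^-1 * lam z) *: moment_point d (t z).
have lamv : represents t (fun z => s^-1 * lam z) v.
  by apply/represents_sum; rewrite -mulr_sumr mulVf // gt_eqF.
have muv : represents t (fun z => s^-1 * mu z) v.
  by move=> p sp; rewrite -lamv // !momentZ lammu.
have s1 : 0 < s^-1 by rewrite invr_gt0.
exists v; split.
  apply: (interior_hull t_inc cX _ _ lamv) => z zX; first by rewrite lamX // mulr0.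
  by rewrite mulr_gt0 // lam_gt0.
apply: (interior_hull t_inc cY _ _ muv) => z zY; first by rewrite muY // mulr0.
by rewrite mulr_gt0 // mu_gt0.
Qed.

Lemma triangulation_noncrossing (T : {set {set 'I_N}}) A B : triangulation d t T ->
  darcs d t T A -> darcs d t T B -> ~ intertwining d A B.
Proof.
move=> [cT disjT _] [_ [X XT AX] _] [_ [Y YT BY] _] AB.
have cX : #|X| = m by rewrite cT // addn1.
have cY : #|Y| = m by rewrite cT // addn1.
have [v vXY] := interiors_meet cX cY AX BY AB.
have [XY|XY] := pselect (X = Y); last by rewrite disjT in vXY.
have /(intertwiningP d N_gt0) [x [y [AE BE xy]]] := AB.
have [w [_ _ wA wB]] := alternating_weights xy; rewrite -AE -BE in wA wB.
have [incx incy] := interlace_increasing xy.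
have : (#|A :|: B| <= #|X|)%N by rewrite subset_leq_card // finset.subUset AX XY.
rewrite cX cardsU (_ : A :&: B = finset.set0) ?cards0 ?subn0.
  by rewrite AE BE !card_arc //; lia.
apply/setP => z; rewrite !inE; apply/negP => /andP [/wA zA /wB zB].
by have := lt_trans zA zB; rewrite ltxx.
Qed.

End Crossing.

(** * The arc that crosses a new arc *)

Section FlippedArc.
Variables (R : realType) (d N : nat) (t : 'I_N -> R).
Hypothesis t_inc : forall i j : 'I_N, (i < j)%N -> t i < t j.
Hypothesis N_gt0 : (0 < N)%N.
Hypothesis d_gt0 : (0 < d)%N.
Implicit Types (T : {set {set 'I_N}}) (X A B : {set 'I_N}).

Local Notation m := (2 * d).+1.
Local Notation point z := (moment_point d (t z)).

Lemma sorted_labels B : #|B| = d.+1 ->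
  exists f : 'I_d.+1 -> 'I_N,
    (forall i j : 'I_d.+1, (i < j)%N -> (f i < f j)%N) /\ B = [set f i | i : 'I_d.+1]%SET.
Proof.
move=> cB; have [z0 _] : exists z0, z0 \in B.
  by apply/set0Pn; rewrite -card_gt0 cB.
pose s := [seq z <- ord_enum N | z \in B].
have sB z : (z \in s) = (z \in B) by rewrite mem_filter mem_ord_enum andbT.
have s_size : size s = d.+1.
  have /card_uniqP <- : uniq s by rewrite filter_uniq // ord_enum_uniq.
  by rewrite -cB; apply: eq_card.
have s_sorted : sorted (relpre (@nat_of_ord N) ltn) s.
  apply: sorted_filter; first by move=> x y z /=; apply: ltn_trans.
  by rewrite -sorted_map val_ord_enum iota_ltn_sorted.
exists (fun i => nth z0 s i); split=> [i j ij|].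
  apply: (sorted_ltn_nth _ z0 s_sorted) => //; last 2 first.
  - by rewrite inE s_size.
  - by rewrite inE s_size.
  by move=> x y z /=; apply: ltn_trans.
apply/setP => z; rewrite -sB; apply/idP/imsetP => [zs|[i _ ->]].
  have lt : (index z s < d.+1)%N by rewrite -s_size index_mem.
  by exists (Ordinal lt) => //=; rewrite nth_index.
by rewrite mem_nth // s_size.
Qed.

Definition centroid_weight B (z : 'I_N) : R := if z \in B then d.+1%:R^-1 else 0.

Lemma enclosing_simplex T B : triangulation d t T -> #|B| = d.+1 ->
  exists X w, [/\ X \in T, forall z, 0 <= w z, supported w X &
    same_moments d t w (centroid_weight B)].
Proof.
move=> [_ _ coverT] cB; pose w0 := centroid_weight B.
have w0_sum : \sum_z w0 z = 1.
  rewrite /w0 /centroid_weight -big_mkcond /= sumr_const cB -[_ *+ _]mulr_natr.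
  by rewrite mulVf // pnatr_eq0.
have rep : represents t w0 (\sum_z w0 z *: point z) by apply/represents_sum.
have : cyclic_polytope t (\sum_z w0 z *: point z).
  apply/hullP; exists w0; split=> // z; last by rewrite inE.
  by rewrite /w0 /centroid_weight; case: ifP => // _; rewrite invr_ge0 ler0n.
rewrite -coverT => -[X /= XT /hullP [w [w_ge0 wX wv]]].
exists X, w; split=> // p sp; rewrite wv // rep //.
Qed.

(** Otherwise the polynomial that vanishes doubly on B, except simply at the two
    ends of the i-th gap, would be positive, up to a global sign, at all points of
    positive weight outside B; its moment is 0 for w0 but positive for w. *)
Lemma gap_weight B (f : 'I_d.+1 -> 'I_N) (w w0 : 'I_N -> R) (z0 : 'I_N) i :
  (forall i j : 'I_d.+1, (i < j)%N -> (f i < f j)%N) -> B = [set f i | i : 'I_d.+1]%SET ->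
  (forall z, 0 <= w z) -> supported w0 B -> same_moments d t w w0 ->
  z0 \notin B -> 0 < w z0 ->
  exists z (q : int), 0 < w z /\
    (f i).+1%:Z < z.+1%:Z + q * N%:Z < (f (ordS i)).+1%:Z + wrap N i.
Proof.
move=> f_inc BE w_ge0 w0B ww0 z0B wz0; apply: contrapT => none.
have f_inj : injective f.
  by move=> j l E; apply: ord_inj; case: (ltngtP j l) => // /f_inc; rewrite E ltnn.
have fB j : f j \in B by rewrite BE imset_f.
have cB : #|B| = d.+1 by rewrite BE card_imset // card_ord.
pose V := (B :\ f i) :\ f (ordS i).
have fi : f (ordS i) != f i by rewrite (inj_eq f_inj) ordS_neq.
have cV : #|V| = d.-1.
  have cBi : #|B :\ f i| = d by have := cardsD1 (f i) B; rewrite cB fB add1n => -[].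
  have Si : f (ordS i) \in B :\ f i by rewrite in_setD1 fi fB.
  by have := cardsD1 (f (ordS i)) (B :\ f i); rewrite cBi Si add1n => ->.
pose P : {poly R} := \prod_(z in V) ('X - (t z)%:P).
(* The last gap is the outside of an interval of labels, which changes the sign. *)
pose e : R := if i == ord_max then -1 else 1.
pose Q := e *: (P ^+ 2 * (('X - (t (f i))%:P) * ('X - (t (f (ordS i)))%:P))).
have sQ : (size Q <= m)%N.
  have sP : size P = d by rewrite size_prodXsubC cV prednK.
  rewrite (leq_trans (size_scale_leq _ _)) // (leq_trans (size_polyMleq _ _)) //.
  have sL : (size (('X - (t (f i))%:P) * ('X - (t (f (ordS i)))%:P))%R <= 3)%N.
    by rewrite (leq_trans (size_polyMleq _ _)) // !size_XsubC.
  have sPP : (size (P ^+ 2)%R <= (d + d).-1)%N.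
    by rewrite expr2 (leq_trans (size_polyMleq _ _)) // sP.
  have le : (((d + d).-1 + 3).-1 <= m)%N by lia.
  apply: leq_trans le; rewrite -[X in (X <= _)%N]subn1 -[X in (_ <= X)%N]subn1.
  by rewrite leq_sub2r // leq_add.
have QB z : z \in B -> Q.[t z] = 0.
  move=> zB; rewrite /Q hornerZ hornerM horner_exp hornerM !hornerXsubC.
  have [->|zi] := eqVneq z (f i); first by rewrite subrr !(mul0r, mulr0).
  have [->|zSi] := eqVneq z (f (ordS i)); first by rewrite subrr !(mul0r, mulr0).
  rewrite horner_prod (bigD1 z) ?inE ?zi ?zSi ?zB //=.
  by rewrite hornerXsubC subrr mul0r expr0n /= !(mul0r, mulr0).
have Qpos z : z \notin B -> 0 < w z -> 0 < Q.[t z].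
  move=> zB wz; rewrite /Q hornerZ hornerM horner_exp hornerM !hornerXsubC.
  have neq j : nat_of_ord z != f j.
    by apply: contra zB => /eqP E; have -> : z = f j by exact: ord_inj.
  have Pz : 0 < P.[t z] ^+ 2.
    rewrite exprn_even_gt0 //= horner_prod prodf_seq_neq0.
    apply/allP => l _; apply/implyP; rewrite !inE => /and3P [_ _ lB].
    rewrite hornerXsubC subr_eq0 (inj_eq (t_inj t_inc)).
    by apply: contraNneq zB => ->.
  rewrite mulrCA pmulr_rgt0 // /e.
  have out q : ~ ((f i).+1%:Z < z.+1%:Z + q * N%:Z < (f (ordS i)).+1%:Z + wrap N i).
    by move=> btw; apply: none; exists z, q.
  have := out 0; have := out 1; have := neq i; have := neq (ordS i).
  have := ltn_ord z; have := ltn_ord (f i); have := ltn_ord (f (ordS i)).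
  rewrite /wrap; have [[iE SE]|[lt /negPf-> SE]] := ordS_cases i.
    rewrite iE eqxx -iE SE => *; rewrite mulN1r oppr_gt0.
    by rewrite pmulr_llt0 ?subr_gt0 ?subr_lt0; apply: t_inc; lia.
  have := f_inc i (ordS i); rewrite SE ltnSn => /(_ isT) fiS *; rewrite mul1r.
  have [lt1|gt1] := ltnP z (f i).
    by rewrite -mulrNN mulr_gt0 // oppr_gt0 subr_lt0; apply: t_inc; lia.
  by rewrite mulr_gt0 // subr_gt0; apply: t_inc; lia.
have : 0 < moment t w Q.
  rewrite /moment (bigD1 z0) //=; apply: ltr_pwDl; first by rewrite mulr_gt0 // Qpos.
  apply: sumr_ge0 => z _; have [zB|zB] := boolP (z \in B); first by rewrite QB // mulr0.
  have := w_ge0 z; rewrite le_eqVlt => /predU1P [<-|wz]; first by rewrite mul0r.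
  by rewrite mulr_ge0 // ltW // Qpos.
rewrite ww0 // (moment_supported _ _ w0B) big1 ?ltxx // => z zB.
by rewrite QB // mulr0.
Qed.

(** Choosing a vertex of X in each gap of B gives a face of X intertwining with B. *)
Lemma crossing_simplex T B : triangulation d t T -> #|B| = d.+1 ->
  (forall X, X \in T -> ~~ (B \subset X)) ->
  exists X A, [/\ X \in T, A \subset X, #|A| = d.+1 & intertwining d B A].
Proof.
move=> triT cB notB; have [f [f_inc BE]] := sorted_labels cB.
have [X [w [XT w_ge0 wX ww0]]] := enclosing_simplex triT cB.
pose w0 := centroid_weight B.
have w0B : supported w0 B by move=> z /negPf zB; rewrite /w0 /centroid_weight zB.
(* The Lagrange polynomials of B tell apart weights supported on B, so if w were
   supported on B then it would be w0, and B would be a face of X. *)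
have [z0 z0B wz0] : exists2 z0, z0 \notin B & 0 < w z0.
  apply: contrapT => none; move/negP: (notB X XT); apply.
  have wB : supported w B.
    move=> z zB; apply: contrapT => /eqP wz; apply: none; exists z => //.
    by rewrite lt0r wz w_ge0.
  apply/fintype.subsetP => z zB; apply: contraT => zX.
  have sL : (size (lagrange t B z) <= m)%N.
    by rewrite (leq_trans (size_lagrange t zB)) // cB; lia.
  have wL u : supported u B -> moment t u (lagrange t B z) = u z.
    move=> uB; rewrite (moment_supported _ _ uB) (bigD1 z) //= big1.
      by rewrite lagrangeE // eqxx mulr1 addr0.
    by move=> l /andP [lB lz]; rewrite lagrangeE // eq_sym (negPf lz) mulr0.
  have := ww0 _ sL; rewrite !wL // wX // /centroid_weight zB => /esym/eqP.
  by rewrite invr_eq0 pnatr_eq0.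
have /fin_all_exists [g gP] : forall i : 'I_d.+1, exists zq : 'I_N * int, 0 < w zq.1 /\
    (f i).+1%:Z < zq.1.+1%:Z + zq.2 * N%:Z < (f (ordS i)).+1%:Z + wrap N i.
  move=> i; have [z [q P]] := gap_weight i f_inc BE w_ge0 w0B ww0 z0B wz0.
  by exists (z, q).
pose b : vec d := [ffun i => (f i).+1%:Z].
pose a : vec d := [ffun i => (g i).1.+1%:Z + (g i).2 * N%:Z].
have ba i : b i < a i < next_entry N b i.
  by rewrite nextE !ffunE; have [] := gP i.
have bB : arc_of N b = B.
  by rewrite BE; apply: (@arc_imset _ _ _ _ (fun=> 0)) => i; rewrite ffunE; lia.
have aE : arc_of N a = [set (g i).1 | i : 'I_d.+1]%SET.
  by apply: (@arc_imset _ _ _ _ (fun i => (g i).2)) => i; rewrite ffunE.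
have [incb inca] := interlace_increasing ba.
exists X, (arc_of N a); split=> //.
- rewrite aE; apply/fintype.subsetP => _ /imsetP [i _ ->].
  by apply: contraT => /wX wz; have [] := gP i; rewrite wz ltxx.
- by rewrite card_arc.
- by apply/(intertwiningP d N_gt0); exists b, a.
Qed.

(** A supporting hyperplane that contains a simplex A contains every simplex
    crossing A, the crossing point being in its relative interior. *)
Lemma crossing_not_boundary A B : intertwining d B A ->
  (forall F, is_facet t F -> ~ (hull (d := d) t B `<=` F)) ->
  forall F, is_facet t F -> ~ (hull (d := d) t A `<=` F).
Proof.
move=> /(intertwiningP d N_gt0) [b [a [BE AE ba]]] Bin F FF AF.
have [w [wU w0 wB wA]] := alternating_weights t_inc N_gt0 ba.
rewrite -AE -BE in wU wB wA.
have [u [c [_ uc FE _]]] := FF.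
(* On the moment curve the supporting affine form is a polynomial of degree 2d. *)
pose L : {poly R} := - c%:P + \sum_(j < 2 * d) (u j 0) *: 'X^(j.+1).
have sL : (size L <= m)%N.
  rewrite (leq_trans (size_polyD _ _)) // geq_max size_polyN.
  rewrite (leq_trans (size_polyC_leq1 _)) //=.
  apply: (leq_trans (size_sum _ _ _)); apply/bigmax_leqP => j _.
  by rewrite (leq_trans (size_scale_leq _ _)) // size_polyXn ltnS.
have LE z : L.[t z] = (point z *m u) 0 0 - c.
  rewrite /L !hornerE horner_sum mxE addrC; congr (_ - _).
  by apply: eq_bigr => j _; rewrite !hornerE !mxE mulrC.
have vertex (X : {set 'I_N}) z : z \in X -> hull t X (point z).
  move=> zX; exists (fun l => (l == z)%:R); split.
  - by move=> l; rewrite ler0n.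
  - by rewrite (bigD1 z) //= eqxx big1 ?addr0 // => l /andP [_ /negPf->].
  - rewrite (bigD1 z) //= eqxx scale1r big1 ?addr0 // => l /andP [_ /negPf->].
    by rewrite scale0r.
have LA z : z \in A -> L.[t z] = 0.
  by move=> zA; have := AF _ (vertex A z zA); rewrite FE LE => -[_ /= ->]; rewrite subrr.
have Lle z : L.[t z] <= 0.
  by rewrite LE subr_le0; apply/uc/vertex; rewrite inE.
have LB z : z \in B -> L.[t z] = 0.
  move=> zB.
  have : \sum_(l in B) w l * (- L.[t l]) == 0.
    under eq_bigr do rewrite mulrN.
    rewrite sumrN oppr_eq0; have := w0 L sL; rewrite moment0 (moment_supported _ _ wU).
    move=> E; apply/eqP; rewrite -[RHS]E [RHS]big_mkcond [LHS]big_mkcond /=.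
    apply: eq_bigr => l _; rewrite inE; case: (l \in B) => //=.
    by case: ifP => // lA; rewrite LA // mulr0.
  rewrite psumr_eq0 => [/allP /(_ z)|l lB]; last first.
    by rewrite mulr_ge0 ?oppr_ge0 // ltW // wB.
  rewrite mem_index_enum zB /= => /(_ isT); rewrite mulf_eq0 oppr_eq0.
  by rewrite gt_eqF ?wB //= => /eqP.
apply: (Bin F FF) => v [l [l0 l1 ->]]; rewrite FE; split.
  exists (fun z => if z \in B then l z else 0); split.
  - by move=> z; case: ifP.
  - by rewrite -[RHS]l1 [RHS]big_mkcond; apply: eq_bigl => z; rewrite inE.
  - rewrite [LHS]big_mkcond; apply: eq_big => [z|z _]; rewrite ?inE //.
    by case: ifP => //; rewrite scale0r.
rewrite /= mulmx_suml summxE (eq_bigr (fun z => l z * c)) => [|z zB].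
  by rewrite -mulr_suml l1 mul1r.
rewrite -scalemxAl mxE; congr (_ * _); apply/eqP; rewrite -subr_eq0 -LE; apply/eqP.
exact: LB.
Qed.

(** The new arc crosses some arc of the old triangulation, and the removed arc
    is the only one that it can cross. *)
Lemma flip_intertwining T T' A B : triangulation d t T ->
  bistellar_flip d t T A T' B -> intertwining d A B.
Proof.
move=> triT [triT' TA notTB T'E].
have T'B : darcs d t T' B by rewrite T'E; right.
have [cB _ Bin] := T'B.
have notB X : X \in T -> ~~ (B \subset X).
  by move=> XT; apply/negP => BX; apply: notTB; split=> //; exists X.
have [X [A' [XT A'X cA' BA']]] := crossing_simplex triT cB notB.
have TA' : darcs d t T A'.
  by split=> //; [exists X|apply: crossing_not_boundary BA' Bin].
have [<-|ne] := pselect (A' = A); first exact: intertwining_sym.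
case: (triangulation_noncrossing t_inc N_gt0 triT' T'B _ BA').
by rewrite T'E; left.
Qed.

End FlippedArc.

(** * Slices and the shape of the flipped vertex *)

Section Slices.
Variables (d N : nat).
Implicit Types (a b x y v : vec d) (i j k : 'I_d.+1).

Local Notation next := (next_entry N).

Lemma sum_gaps a : \sum_i (next a i - a i) = N%:Z.
Proof.
rewrite sumrB (eq_bigr (fun i => a (ordS i) + wrap N i)) // big_split /=.
rewrite [X in X + _ - _](_ : _ = \sum_i a i).
  by rewrite addrAC subrr add0r -big_mkcond big_pred1_eq.
by rewrite [RHS](reindex_inj (@ordS_inj d.+1)).
Qed.

Lemma tvert_shift a m : tvert N a -> tvert N (a + ones d *~ m).
Proof.
by move=> /tvertP ta; apply/tvertP => i; have := ta i; rewrite !nextE !vecE; lia.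
Qed.

Variable S : set (vec d).
Hypothesis sliceS : is_slice N S.

Lemma slice_tvert x : S x -> tvert N x.
Proof. by have [sub _ _] := sliceS; apply: sub. Qed.

Lemma slice_rep v : tvert N v -> exists m, S (v + ones d *~ m).
Proof.
move=> tv; have [_ rep _] := sliceS; have [b [[Sb [m bE]] _]] := rep v tv.
by exists (- m); rewrite mulrNz -bE.
Qed.

Lemma slice_uniq x m : S x -> S (x + ones d *~ m) -> m = 0.
Proof.
move=> Sx Sxm; have [_ rep _] := sliceS.
have [b [_ uniq]] := rep x (slice_tvert Sx).
have bx : b = x by apply: uniq; split=> //; exists 0; rewrite mulr0z subr0.
have : b = x + ones d *~ m by apply: uniq; split=> //; exists (- m); rewrite mulrNz opprK.
by rewrite bx => /(congr1 (fun v : vec d => v ord0)); rewrite !vecE; lia.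
Qed.

Hypothesis d_gt0 : (0 < d)%N.

Lemma tvert_addP a i : tvert N a -> tvert N (a + unitvec i) <-> a i + 3 <= next a i.
Proof.
move=> /tvertP ta; split=> [/tvertP /(_ i)|ai].
  by rewrite !nextE !vecE eqxx (negPf (ordS_neq i d_gt0)); lia.
apply/tvertP => j; have := ta j; rewrite !nextE !vecE.
by have [->|_] := eqVneq j i; rewrite ?nextE in ai *; lia.
Qed.

Lemma tvert_subP a i : tvert N a ->
  tvert N (a - unitvec (ordS i)) <-> a i + 3 <= next a i.
Proof.
move=> /tvertP ta; split=> [/tvertP /(_ i)|ai].
  by rewrite !nextE !vecE eqxx eq_sym (negPf (ordS_neq i d_gt0)); lia.
apply/tvertP => j; have := ta j; rewrite !nextE !vecE (inj_eq (@ordS_inj _)).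
by have [->|_] := eqVneq j i; rewrite ?nextE in ai *; lia.
Qed.

Hypothesis N_big : (2 * d.+1 < N)%N.

(** If no coordinate could be raised towards y, all gaps of x would be minimal,
    and N would be 2 (d + 1). *)
Lemma raisable x y : tvert N x -> tvert N y -> (forall i, x i <= y i) -> x != y ->
  exists i, x i < y i /\ x i + 3 <= next x i.
Proof.
move=> /tvertP tx /tvertP ty xy neq; apply: contrapT => stuck.
have lt_gap i : x i < y i -> next x i = x i + 2.
  move=> lt; apply: contrapT => ne2; case: stuck; exists i; split=> //.
  by have := tx i; lia.
have [i0 lt0] : exists i, x i < y i.
  apply: contrapT => none; move/eqP: neq; apply; apply: vec_ext => i.
  apply: contrapT => ne; case: none; exists i; have := xy i; lia.
have lt i : x i < y i.
  move: i; apply: (cyclic_ind lt0) => i lti.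
  by have := ty i; have := lt_gap i lti; rewrite !nextE; lia.
have := sum_gaps x; rewrite (eq_bigr (fun=> 2)) => [|i _].
  by rewrite sumr_const card_ord; lia.
by rewrite lt_gap //; lia.
Qed.

Lemma monotone_path x y : tvert N x -> tvert N y -> (forall i, x i <= y i) ->
  exists p, path (@tarrow d N) x p /\ last x p = y.
Proof.
move=> tx ty xy.
have [m mE] : exists m : nat, \sum_i (y i - x i) = m%:Z.
  exists (absz (\sum_i (y i - x i))); rewrite gez0_abs //.
  by apply: sumr_ge0 => i _; have := xy i; lia.
elim: m x tx xy mE => [|m IHm] x tx xy mE.
  exists [::]; split=> //=; apply: vec_ext => i.
  have ge0 j : xpredT j -> 0 <= y j - x j by move=> _; have := xy j; lia.
  have /eqP := mE; rewrite psumr_eq0 // => /allP /(_ i).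
  by rewrite mem_index_enum => /(_ isT) /eqP; lia.
have neq : x != y.
  apply/eqP => E; move: mE; rewrite E big1 => [|i _]; by lia.
have [i [lti gap]] := raisable tx ty xy neq.
have tx' : tvert N (x + unitvec i) by apply/tvert_addP.
have [||p [pp lp]] := IHm (x + unitvec i) tx'.
- by move=> j; have := xy j; rewrite !vecE; case: eqP => [->|_]; lia.
- have -> : \sum_j (y j - (x + unitvec i) j) = \sum_j (y j - x j) - 1.
    rewrite (eq_bigr (fun j => (y j - x j) - (j == i)%:R)) => [|j _].
      rewrite sumrB; congr (_ - _).
      by rewrite (bigD1 i) //= eqxx big1 ?addr0 // => j /negPf->.
    by rewrite !vecE; lia.
  by rewrite mE; lia.
exists (x + unitvec i :: p); split=> //=; rewrite pp andbT /tarrow tx tx' /=.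
by apply/existsP; exists i.
Qed.

Lemma slice_convex x v y : S x -> S y -> tvert N v ->
  (forall i, x i <= v i <= y i) -> S v.
Proof.
move=> Sx Sy tv xvy; have [_ _ conv] := sliceS.
have [|p [pp lp]] := monotone_path (slice_tvert Sx) tv.
  by move=> i; have := xvy i; lia.
have [|q [pq lq]] := monotone_path tv (slice_tvert Sy).
  by move=> i; have := xvy i; lia.
apply: (conv x (p ++ q)) => //.
- by rewrite cat_path pp lp.
- by rewrite last_cat lp lq.
- by rewrite -cat_cons mem_cat -lp mem_last.
Qed.

(** The vertex x + 1 would lie between x and y, in the orbit of x. *)
Lemma slice_antichain x y : S x -> S y -> ~ (forall i, x i + 1 <= y i).
Proof.
move=> Sx Sy xy; suff /(slice_uniq Sx): S (x + ones d *~ 1) by [].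
apply: (slice_convex Sx Sy); first exact/tvert_shift/slice_tvert.
by move=> i; rewrite !vecE; have := xy i; lia.
Qed.

Lemma slice_between x v : S x -> tvert N v -> (forall i, x i <= v i <= x i + 1) ->
  S v \/ S (v - ones d).
Proof.
move=> Sx tv xv; have [m Sm] := slice_rep tv.
have [E|[E|[m1|m2]]] : m = 0 \/ (m = -1 \/ (1 <= m \/ m <= -2)) by lia.
- by rewrite E mulr0z addr0 in Sm; left.
- by rewrite E mulrNz in Sm; right.
- case: (slice_antichain Sx Sm) => i; rewrite !vecE; have := xv i; lia.
- by case: (slice_antichain Sm Sx) => i; rewrite !vecE; have := xv i; lia.
Qed.

Variable a : vec d.
Hypothesis Sa : S a.
Hypothesis no_retrograde : forall i, S (a - unitvec i) -> ~ S (a + unitvec (ord_pred i)).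

(** The cycle a -> a + E_i -> ... -> a + 1 - E_(i+1) -> a + 1 has its first arrow in
    S, so without a retrograde path its last arrow, shifted to end at a, is not in
    S. *)
Lemma cut_out_arrow i : S (a + unitvec i) -> S (a + ones d - unitvec (ordS i)).
Proof.
move=> Si; have ta := slice_tvert Sa.
have gap : a i + 3 <= next a i by apply/tvert_addP => //; apply: slice_tvert.
have tv : tvert N (a + ones d - unitvec (ordS i)).
  rewrite addrAC -[ones d]mulr1z; apply: tvert_shift.
  by apply/tvert_subP.
have [|//|] := slice_between Sa tv; first by move=> j; rewrite !vecE; lia.
rewrite (addrAC a) addrK => /no_retrograde; rewrite ordSK => /(_ Si) [].
Qed.

Lemma cut_in_arrow i : S (a - unitvec (ordS i)) -> S (a - ones d + unitvec i).
Proof.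
move=> Si; have ta := slice_tvert Sa.
have gap : a i + 3 <= next a i by apply/tvert_subP => //; apply: slice_tvert.
have tv : tvert N (a + unitvec i) by apply/tvert_addP.
have [||] := slice_between Sa tv; first by move=> j; rewrite !vecE; lia.
  by have := no_retrograde Si; rewrite ordSK.
by rewrite addrAC.
Qed.

(** Otherwise a - 1 + E_(j-1) and a + 1 - E_(i+1) would contradict
    [slice_antichain]. *)
Lemma slice_out_in i j : S (a + unitvec i) -> S (a - unitvec j) -> j = ordS (ordS i).
Proof.
move=> Si; rewrite -{1}[j]ord_predK => Sj.
apply: contrapT => ne; case: (slice_antichain (cut_in_arrow Sj) (cut_out_arrow Si)).
move=> l; rewrite !vecE; have [->|] := eqVneq l (ord_pred j); last by lia.
have /negPf-> : ord_pred j != ordS i; last by lia.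
by apply/eqP => E; apply: ne; rewrite -E ord_predK.
Qed.

(** Take k = i + 1. Any gap of size at least 3 gives an arrow of S out of a or into
    a, by [slice_between] and [slice_convex], and by [slice_out_in] there is only
    one of each kind. *)
Lemma flip_type i j : S (a + unitvec i) -> S (a - unitvec j) ->
  exists k, 
   [/\ a (ord_pred k) + 3 <= next a (ord_pred k), a k + 3 <= next a k &
       forall l, l != k -> l != ord_pred k -> next a l = a l + 2] /\
   [/\ S (a + unitvec (ord_pred k)), S (a + ones d - unitvec k),
       S (a - unitvec (ordS k)) & S (a - ones d + unitvec k)].
Proof.
move=> Si Sj; exists (ordS i); rewrite ordSK.
have jE := slice_out_in Si Sj; rewrite jE in Sj.
have ta := slice_tvert Sa.
split; split=> //; [| | | exact: cut_out_arrow | exact: cut_in_arrow].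
- by apply/tvert_addP => //; apply: slice_tvert.
- by apply/tvert_subP => //; apply: slice_tvert.
move=> l ne1 ne2; apply: contrapT => ne.
have gap : a l + 3 <= next a l by move/tvertP: ta => /(_ l); lia.
have tl : tvert N (a + unitvec l) by apply/tvert_addP.
have [||Sl] := slice_between Sa tl; first by move=> m; rewrite !vecE; lia.
  move=> Sl; move/eqP: ne2; apply.
  by have := slice_out_in Sl Sj => /ordS_inj/ordS_inj.
have Sl' : S (a - unitvec (ordS l)).
  apply: (slice_convex Sl Sa); first by apply/tvert_subP.
  move=> m; rewrite !vecE; have [->|_] := eqVneq m l; last by lia.
  by rewrite eq_sym (negPf (ordS_neq l d_gt0)); lia.
by have := slice_out_in Si Sl' => /ordS_inj E; rewrite E eqxx in ne1.
Qed.

End Slices.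

(** * Arrows before and after the flip *)

Section FlipCombinatorics.
Variables (d N : nat) (S : set (vec d)) (D D' : set {set 'I_N}) (a : vec d)
  (k : 'I_d.+1) (B : {set 'I_N}).
Implicit Types (x y : vec d) (X Y Z : {set 'I_N}) (i j l : 'I_d.+1).
Hypotheses (d_gt0 : (0 < d)%N) (N_big : (2 * d.+1 < N)%N) (sliceS : is_slice N S).
Hypotheses (arcD : forall x, S x -> D (arc_of N x))
  (arc_inj : forall x y, S x -> S y -> arc_of N x = arc_of N y -> x = y).
Hypotheses (crossD : forall X Y, D X -> D Y -> ~ intertwining d X Y)
  (crossD' : forall X Y, D' X -> D' Y -> ~ intertwining d X Y).
Hypotheses (D'E : D' = (D `\ arc_of N a) `|` [set B]) (notDB : ~ D B).

Local Notation next := (next_entry N).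
Local Notation p := (ord_pred k).

(* The shape of a given by [flip_type]. *)
Hypotheses (gap_p : a p + 3 <= next a p) (gap_k : a k + 3 <= next a k)
  (gap_other : forall l, l != k -> l != p -> next a l = a l + 2).

Local Notation up_p := (a + unitvec p).
Local Notation down_s := (a - unitvec (ordS k)).
Local Notation before := (a + ones d - unitvec k).
Local Notation after := (a - ones d + unitvec k).

Hypotheses (Sa : S a) (S_up : S up_p) (S_down : S down_s)
  (S_before : S before) (S_after : S after).

Let N_gt0 : (0 < N)%N. Proof. by lia. Qed.

Let p_neq_k : p != k. Proof. exact: ord_pred_neq. Qed.

Let s_neq_k : ordS k != k. Proof. exact: ordS_neq. Qed.

Let gp : a p + 3 <= a k + wrap N p.
Proof. by move: gap_p; rewrite nextE ord_predK. Qed.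

Let gk : a k + 3 <= a (ordS k) + wrap N k.
Proof. exact: gap_k. Qed.

Let gl l : l != k -> l != p -> a (ordS l) + wrap N l = a l + 2.
Proof. exact: gap_other. Qed.

Let ordS_eq_k l : (ordS l == k) = (l == p).
Proof. by rewrite -{1}(ord_predK k) (inj_eq (@ordS_inj _)). Qed.

Let ordS_eq_s l : (ordS l == ordS k) = (l == k).
Proof. by rewrite (inj_eq (@ordS_inj _)). Qed.

Let interlaced x y : (forall i, x i < y i < next x i) ->
  intertwining d (arc_of N x) (arc_of N y).
Proof. by move=> xy; apply/(intertwiningP d N_gt0); exists x, y. Qed.

Let incS x : S x -> cyclic_increasing N x.
Proof. by move=> Sx; apply/tvert_increasing/(slice_tvert sliceS). Qed.

Lemma three_cases (Q : 'I_d.+1 -> Prop) :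
  Q k -> Q p -> (forall l, l != k -> l != p -> Q l) -> forall l, Q l.
Proof.
move=> Qk Qp Ql l; have [->//|lk] := eqVneq l k; have [->//|lp] := eqVneq l p.
exact: Ql.
Qed.

Let D'_other x : S x -> x <> a -> D' (arc_of N x).
Proof.
move=> Sx xa; rewrite D'E; left; split; first exact: arcD.
by move=> /(arc_inj Sx Sa).
Qed.

Let up_neq : up_p <> a.
Proof. by move=> /(congr1 (fun v : vec d => v p)); rewrite !vecE eqxx; lia. Qed.

Let down_neq : down_s <> a.
Proof. by move=> /(congr1 (fun v : vec d => v (ordS k))); rewrite !vecE eqxx; lia. Qed.

Let before_neq : before <> a.
Proof.
by move=> /(congr1 (fun v : vec d => v p)); rewrite !vecE (negPf p_neq_k); lia.
Qed.

Let after_neq : after <> a.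
Proof.
by move=> /(congr1 (fun v : vec d => v p)); rewrite !vecE (negPf p_neq_k); lia.
Qed.

Local Notation b := (flipped N a k).

Let b_k : b k = next a k - 1. Proof. by rewrite ffunE eqxx. Qed.

Let b_other l : l != k -> b l = a l + 1. Proof. by rewrite ffunE => /negPf->. Qed.

(** Where a has gap 2 there is one position strictly inside the gap. In the gaps at
    p and k, any position other than a_p + 1 and a_(k+1) - 1, respectively, would
    make B intertwine with a + E_p or a - E_(k+1), which are still arcs after the
    flip. *)
Lemma flipped_arc : intertwining d (arc_of N a) B -> B = arc_of N b.
Proof.
move=> /(intertwiningP d N_gt0) [x [y [xE yE xy]]].
have [c [cE ac]] := relift_left N_gt0 xy (incS Sa) xE.
have D'B : D' B by rewrite D'E; right.
rewrite yE -cE; congr arc_of; apply: vec_ext; apply: three_cases.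
- rewrite b_k; apply: contrapT => ne.
  apply: (crossD' (D'_other S_down down_neq) D'B); rewrite yE -cE.
  apply: interlaced => l; have := ac l; rewrite !nextE !vecE ordS_eq_s.
  have [->|_] := eqVneq l k; last by case: eqP; lia.
  by have := ac k; rewrite nextE eq_sym (negPf s_neq_k) in ne *; lia.
- rewrite b_other //; apply: contrapT => ne.
  apply: (crossD' (D'_other S_up up_neq) D'B); rewrite yE -cE.
  apply: interlaced => l; have := ac l; rewrite !nextE !vecE.
  have [->|_] := eqVneq l p; last by case: eqP; lia.
  by rewrite ord_predK eq_sym (negPf p_neq_k); lia.
- by move=> l lk lp; rewrite b_other //; have := ac l; rewrite nextE gl //; lia.
Qed.

Hypothesis BE : B = arc_of N b.

(** The rotation of b with next b0 = b; as b is a lift of B convenient for the arcs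
    before B, so is b0 for the arcs after B. *)
Let b0 : vec d := [ffun l => if l == k then a p + 1 - wrap N p else a l - 1].

Let b0_k : b0 k = a p + 1 - wrap N p. Proof. by rewrite ffunE eqxx. Qed.

Let b0_other l : l != k -> b0 l = a l - 1. Proof. by rewrite ffunE => /negPf->. Qed.

Let next_b0 l : next b0 l = b l.
Proof.
move: l; apply: three_cases => [||l lk lp]; rewrite nextE.
- by rewrite b0_other // b_k nextE; lia.
- by rewrite ord_predK b0_k b_other //; lia.
- by rewrite b0_other ?ordS_eq_k // b_other //; have := gl lk lp; lia.
Qed.

Let inc_b0 : cyclic_increasing N b0.
Proof.
move=> l; rewrite next_b0; move: l; apply: three_cases => [||l lk lp].
- by rewrite b0_k b_k nextE; lia.
- by rewrite b0_other // b_other //; lia.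
- by rewrite b0_other // b_other //; lia.
Qed.

Let b0E : arc_of N b0 = B.
Proof.
rewrite BE; apply/(arc_periodic N_gt0)/seteqP; split=> z [l [q ->]]; last first.
  by rewrite -next_b0; apply/periodicD/periodic_next.
have -> : b0 l = b (ord_pred l) - wrap N (ord_pred l).
  by rewrite -next_b0 nextE ord_predK; lia.
exists (ord_pred l), (q - (ord_pred l == ord_max)%:R).
by rewrite /wrap; case: eqP => _; lia.
Qed.

Let inc_b : cyclic_increasing N b.
Proof.
move=> l; rewrite nextE -!next_b0; have := inc_b0 (ordS l); rewrite !nextE; lia.
Qed.

Let D'P Z : D' Z -> (D Z /\ Z <> arc_of N a) \/ Z = B.
Proof. by rewrite D'E => -[[]|->]; [left|right]. Qed.

Let D'B : D' B. Proof. by rewrite D'E; right. Qed.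

Let D'_D Z : D Z -> Z <> arc_of N a -> D' Z.
Proof. by rewrite D'E; left. Qed.

Let Dneq Z : D Z -> Z <> B.
Proof. by move=> DZ ZB; apply: notDB; rewrite -ZB. Qed.

(** The inequalities leave only the entry x_k free, and X does not intertwine with
    a. *)
Lemma precedes_new X : D X -> precedes d X B ->
  exists x, [/\ X = arc_of N x, forall l, l != k -> x l = a l + 1, x k <= a k &
                a p + 3 <= x k + wrap N p].
Proof.
move=> DX; rewrite BE => /(precedes_liftl N_gt0 inc_b) [x [XE xb]].
have xl l : l != k -> x l = a l + 1.
  move=> lk; have := xb (ord_pred l); have := xb l.
  rewrite !nextE ord_predK b_other //.
  have [lE|ne] := eqVneq (ord_pred l) k.
    by rewrite lE b_k nextE -lE ord_predK; lia.
  have lp' : ord_pred l != p by rewrite (inj_eq (@ord_pred_inj _)).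
  by rewrite b_other //; have := gl ne lp'; rewrite ord_predK; lia.
have := xb p; rewrite nextE ord_predK b_other // => xp.
have xk : x k <= a k; last by exists x; split=> //; lia.
rewrite leNgt; apply/negP => lt; apply: (crossD (arcD Sa) DX); rewrite XE.
apply: interlaced => l; move: l; apply: three_cases => [||l lk lp].
- by have := xb k; rewrite b_k nextE; lia.
- by rewrite nextE ord_predK xl //; lia.
- by rewrite nextE xl // gl //; lia.
Qed.

Lemma new_precedes Y : D Y -> precedes d B Y ->
  exists y, [/\ Y = arc_of N y, forall l, l != k -> y l = a l - 1, a k <= y k &
                y k + 3 <= next a k].
Proof.
move=> DY; rewrite -b0E => /(precedes_liftr N_gt0 inc_b0) [y [YE by_]].
have yl l : l != k -> y l = a l - 1.
  by move=> lk; have := by_ l; rewrite next_b0 b0_other // b_other //; lia.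
have := by_ k; rewrite next_b0 b0_k b_k => yk.
have ak : a k <= y k; last by exists y; split=> //; lia.
rewrite leNgt; apply/negP => lt; apply: (crossD DY (arcD Sa)); rewrite YE.
apply: interlaced => l; move: l; apply: three_cases => [||l lk lp].
- by rewrite nextE (yl (ordS k)) //; lia.
- by rewrite nextE ord_predK yl //; lia.
- by rewrite nextE yl // yl ?ordS_eq_k //; have := gl lk lp; lia.
Qed.

Let before_new : precedes d (arc_of N before) B.
Proof.
rewrite BE; apply: (precedesI N_gt0) => l; move: l.
apply: three_cases => [||l lk lp]; rewrite nextE !vecE.
- by rewrite b_k nextE eqxx (negPf s_neq_k); lia.
- by rewrite b_other // ord_predK eqxx (negPf p_neq_k); lia.
- by rewrite b_other // ordS_eq_k (negPf lk) (negPf lp); have := gl lk lp; lia.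
Qed.

Let new_after : precedes d B (arc_of N after).
Proof.
rewrite -b0E; apply: (precedesI N_gt0) => l; rewrite next_b0; move: l.
apply: three_cases => [||l lk lp]; rewrite !vecE.
- by rewrite b0_k b_k nextE eqxx; lia.
- by rewrite b0_other // b_other // (negPf p_neq_k); lia.
- by rewrite b0_other // b_other // (negPf lk); lia.
Qed.

Let before_k : before k = a k. Proof. by rewrite !vecE eqxx; lia. Qed.
Let before_other l : l != k -> before l = a l + 1.
Proof. by rewrite !vecE => /negPf->; lia. Qed.
Let after_k : after k = a k. Proof. by rewrite !vecE eqxx; lia. Qed.
Let after_other l : l != k -> after l = a l - 1.
Proof. by rewrite !vecE => /negPf->; lia. Qed.

Let not_a x : S x -> x <> a -> arc_of N x <> arc_of N a.
Proof. by move=> Sx xa /(arc_inj Sx Sa). Qed.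

(** Every arc preceding B also precedes [before], by [precedes_new], so that only
    the latter is an immediate predecessor. *)
Lemma arrow_into_new X : D' X -> X <> B ->
  qarr (arc_quiver d D') X B <-> X = arc_of N before.
Proof.
move=> /D'P [[DX XA]|//] XB; split=> [[_ _ _ XpB none]|XE].
  have [x [XE xl xk xp]] := precedes_new DX XpB.
  have x_before l : x l <= before l <= next x l - 2.
    move: l; apply: three_cases => [||l lk lp].
    - by rewrite before_k nextE (xl (ordS k)) //; lia.
    - by rewrite before_other // nextE ord_predK xl //; lia.
    - by rewrite before_other // nextE !xl ?ordS_eq_k //; have := gl lk lp; lia.
  apply: contrapT => ne; apply: none; exists (arc_of N before); split=> //.
  - exact: D'_other.
  - by move/esym.
  - exact/Dneq/arcD.
  - by rewrite XE; apply: (precedesI N_gt0).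
split=> //; first exact: D'_D.
  by rewrite XE.
case=> Z [/D'P [[DZ ZA]|//] ZX ZB XZ ZpB].
have [z [ZE zl zk zp]] := precedes_new DZ ZpB.
rewrite XE in XZ; have [z' [ZE' bz']] := precedes_liftr N_gt0 (incS S_before) XZ.
have E : periodic N z = periodic N z'.
  by apply/(arc_periodic N_gt0); rewrite -ZE -ZE'.
have incz : cyclic_increasing N z.
  move=> l; rewrite nextE; move: l; apply: three_cases => [||l lk lp].
  - by rewrite (zl (ordS k)) //; lia.
  - by rewrite ord_predK zl //; lia.
  - by rewrite !zl ?ordS_eq_k //; have := gl lk lp; lia.
have := bz' k; rewrite before_k nextE before_other // => z'k.
have [lt|le] := ltrP (z k) (z' k).
  have := next_le_periodic incz _ lt; rewrite E => /(_ (periodic_entry _ _ _)).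
  by rewrite nextE zl //; lia.
apply: ZX; rewrite XE ZE; congr arc_of; apply: vec_ext => l.
have [->|lk] := eqVneq l k; first by rewrite before_k; lia.
by rewrite zl // before_other.
Qed.

Lemma arrow_from_new Y : D' Y -> Y <> B ->
  qarr (arc_quiver d D') B Y <-> Y = arc_of N after.
Proof.
move=> /D'P [[DY YA]|//] YB; split=> [[_ _ _ BpY none]|YE].
  have [y [YE yl yk yp]] := new_precedes DY BpY.
  have after_y l : after l <= y l <= next after l - 2.
    move: l; apply: three_cases => [||l lk lp]; rewrite nextE.
    - by rewrite after_k after_other //; rewrite nextE in yp; lia.
    - by rewrite ord_predK after_k after_other // yl //; lia.
    - by rewrite !after_other ?ordS_eq_k // yl //; have := gl lk lp; lia.
  apply: contrapT => ne; apply: none; exists (arc_of N after); split=> //.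
  - exact: D'_other.
  - exact/Dneq/arcD.
  - by move/esym.
  - by rewrite YE; apply: (precedesI N_gt0).
split=> //; first exact: D'_D.
- exact/nesym.
- by rewrite YE.
case=> Z [/D'P [[DZ ZA]|//] ZB ZY BpZ ZpY].
have [z [ZE zl zk zp]] := new_precedes DZ BpZ.
rewrite YE in ZpY; have [z' [ZE' z'a]] := precedes_liftl N_gt0 (incS S_after) ZpY.
have E : periodic N z = periodic N z'.
  by apply/(arc_periodic N_gt0); rewrite -ZE -ZE'.
have incz : cyclic_increasing N z.
  move=> l; rewrite nextE; move: l; apply: three_cases => [||l lk lp].
  - by rewrite (zl (ordS k)) //; rewrite nextE in zp; lia.
  - by rewrite ord_predK zl //; lia.
  - by rewrite !zl ?ordS_eq_k //; have := gl lk lp; lia.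
have := z'a k; rewrite after_k => z'k.
have := z'a p; rewrite after_other // => z'p.
have lt : z p < next z' p by rewrite zl //; lia.
have := next_le_periodic incz _ lt; rewrite E => /(_ (periodic_next _ _ _)).
rewrite !nextE ord_predK => le.
apply: ZY; rewrite YE ZE; congr arc_of; apply: vec_ext => l.
have [->|lk] := eqVneq l k; first by rewrite after_k; lia.
by rewrite zl // after_other.
Qed.

(** An arc X preceding B has x_(k-1) = a_(k-1) + 1 and x_k <= a_k, while an arc Y
    following B has the consecutive entries a_(k-1) - 1 and y_k >= a_k. Hence no
    entry of Y lies in the interval from x_(k-1) to x_k - 2. *)
Lemma new_not_between X Y : D X -> D Y -> precedes d X B -> precedes d B Y ->
  ~ precedes d X Y.
Proof.
move=> DX DY /(precedes_new DX) [x [-> xl xk xp]].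
move=> /(new_precedes DY) [y [-> yl yk yp]] XY.
have incx : cyclic_increasing N x.
  move=> l; rewrite nextE; move: l; apply: three_cases => [||l lk lp].
  - by rewrite (xl (ordS k)) //; lia.
  - by rewrite ord_predK xl //; lia.
  - by rewrite !xl ?ordS_eq_k //; have := gl lk lp; lia.
have incy : cyclic_increasing N y.
  move=> l; rewrite nextE; move: l; apply: three_cases => [||l lk lp].
  - by rewrite (yl (ordS k)) //; rewrite nextE in yp; lia.
  - by rewrite ord_predK yl //; lia.
  - by rewrite !yl ?ordS_eq_k //; have := gl lk lp; lia.
have [y' [E xy']] := precedes_liftr N_gt0 incx XY.
move/(arc_periodic N_gt0): E => E.
have := xy' p; rewrite nextE ord_predK xl // => y'p.
have lt : y p < y' p by rewrite yl //; lia.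
have := next_le_periodic incy _ lt; rewrite E => /(_ (periodic_entry _ _ _)).
by rewrite nextE ord_predK; lia.
Qed.

Section HigherDimension.
Hypothesis d_gt1 : (1 < d)%N.

Let s_neq_p : ordS k != p.
Proof.
apply/eqP => /(congr1 (@ordS _)); rewrite ord_predK => /(congr1 (@nat_of_ord _)).
have [[kE SE]|[lt _ SE]] := ordS_cases k.
  rewrite SE; have [[E _]|[_ _ ->]] := ordS_cases (@ord0 d); last by rewrite kE /=; lia.
  by have := congr1 (@nat_of_ord _) E; rewrite /=; lia.
have [[SkE ->]|[_ _ ->]] := ordS_cases (ordS k); last by lia.
by move: (congr1 (@nat_of_ord _) SkE); rewrite SE /=; lia.
Qed.

Local Notation corner := (a + unitvec p - unitvec (ordS k)).

Let S_corner : S corner.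
Proof.
apply: (slice_convex sliceS d_gt0 N_big S_down S_up); last first.
  by move=> l; rewrite !vecE; case: eqP; case: eqP; lia.
apply/tvertP => l; move: l; apply: three_cases => [||l lk lp].
- rewrite nextE !vecE eqxx (negPf s_neq_p) ![k == _]eq_sym.
  by rewrite (negPf p_neq_k) (negPf s_neq_k); lia.
- rewrite nextE !vecE ord_predK eqxx ![k == _]eq_sym [p == ordS k]eq_sym.
  by rewrite (negPf p_neq_k) (negPf s_neq_k) (negPf s_neq_p); lia.
- rewrite nextE !vecE ordS_eq_s (negPf lk) (negPf lp).
  by have := gl lk lp; case: eqP; case: eqP; lia.
Qed.

(** When a is between two old arcs, these are a - s E_(k+1) and a + r E_(k-1),
    and the corner a - E_(k+1) + E_(k-1) is between them as well. This needs
    k - 1 and k + 1 to be distinct modulo d + 1. *)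
Lemma old_replaceable X Y : D X -> D Y -> X <> arc_of N a -> Y <> arc_of N a ->
  precedes d X (arc_of N a) -> precedes d (arc_of N a) Y ->
  exists Z, [/\ D Z /\ Z <> arc_of N a, Z <> X, Z <> Y, precedes d X Z &
                precedes d Z Y].
Proof.
move=> DX DY XA YA /(precedes_liftl N_gt0 (incS Sa)) [x [XE xa]].
move=> /(precedes_liftr N_gt0 (incS Sa)) [y [YE ay]].
have xl l : l != k -> l != ordS k -> x l = a l.
  move=> lk ls; have := xa (ord_pred l); have := xa l; rewrite !nextE ord_predK.
  have ne : ord_pred l != k by rewrite -(inj_eq (@ordS_inj _)) ord_predK.
  have lp : ord_pred l != p by rewrite (inj_eq (@ord_pred_inj _)).
  by have := gl ne lp; rewrite ord_predK; lia.
have yl l : l != k -> l != p -> y l = a l.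
  by move=> lk lp; have := ay l; rewrite nextE; have := gl lk lp; lia.
have xp := xa p; rewrite nextE ord_predK in xp.
have xk := xa k; rewrite nextE in xk.
have xs := xa (ordS k).
have yp := ay p; rewrite nextE ord_predK in yp.
have yk := ay k; rewrite nextE in yk.
have ykE : y k = a k.
  apply: contrapT => ne; apply: (crossD (arcD S_after) DY); rewrite YE.
  apply: interlaced => l; move: l; apply: three_cases => [||l lk lp]; rewrite nextE.
  - by rewrite after_k after_other //; lia.
  - by rewrite ord_predK after_k after_other //; lia.
  - by rewrite !after_other ?ordS_eq_k // yl //; have := gl lk lp; lia.
have xkE : x k = a k.
  apply: contrapT => ne; apply: (crossD DX (arcD S_before)); rewrite XE.
  apply: interlaced => l; move: l; apply: three_cases => [||l lk lp]; rewrite nextE.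
  - by rewrite before_k; have := xa k; rewrite nextE; lia.
  - by rewrite ord_predK before_other //; have := xa p; lia.
  - rewrite before_other //; have := xa l.
    by rewrite [x (ordS l)]xl ?ordS_eq_s ?ordS_eq_k //; have := gl lk lp; lia.
have xsE : x (ordS k) < a (ordS k).
  rewrite ltNge; apply/negP => ge; apply: XA; rewrite XE; congr arc_of.
  apply: vec_ext => l; have [->//|lk] := eqVneq l k.
  by have [->|ls] := eqVneq l (ordS k); [lia|exact: xl].
have ypE : a p < y p.
  rewrite ltNge; apply/negP => ge; apply: YA; rewrite YE; congr arc_of.
  apply: vec_ext => l; have [->//|lk] := eqVneq l k.
  by have [->|lp] := eqVneq l p; [lia|exact: yl].
have corner_p : corner p = a p + 1.
  by rewrite !vecE eqxx [p == _]eq_sym (negPf s_neq_p); lia.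
have corner_s : corner (ordS k) = a (ordS k) - 1.
  by rewrite !vecE eqxx (negPf s_neq_p); lia.
have corner_k : corner k = a k.
  by rewrite !vecE ![k == _]eq_sym (negPf p_neq_k) (negPf s_neq_k); lia.
have corner_l l : l != p -> l != ordS k -> corner l = a l.
  by move=> lp ls; rewrite !vecE (negPf lp) (negPf ls); lia.
have x_corner l : x l <= corner l <= next x l - 2.
  move: l; apply: three_cases => [||l lk lp]; rewrite nextE.
  - by rewrite corner_k; lia.
  - by rewrite ord_predK corner_p; lia.
  - rewrite [x (ordS l)]xl ?ordS_eq_s ?ordS_eq_k //; have := gl lk lp.
    have [->|ls] := eqVneq l (ordS k); first by rewrite corner_s; lia.
    by rewrite corner_l // xl //; lia.
have corner_y l : corner l <= y l <= next corner l - 2.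
  move: l; apply: three_cases => [||l lk lp]; rewrite nextE.
  - by rewrite corner_k corner_s; lia.
  - by rewrite ord_predK corner_k corner_p; lia.
  - rewrite yl //; have := gl lk lp.
    have -> : corner (ordS l) = a (ordS l) + (ordS l == p)%:R.
      by rewrite !vecE ordS_eq_s (negPf lk); lia.
    have [->|ls] := eqVneq l (ordS k); first by rewrite corner_s; lia.
    by rewrite corner_l //; lia.
exists (arc_of N corner); split.
- split; first exact: arcD.
  by apply: not_a => // /(congr1 (fun v : vec d => v p)); rewrite corner_p; lia.
- rewrite XE => E.
  have : corner = x.
    apply: (@lift_uniq _ _ N_gt0 x _ _ _ _ E) => l; first by have := x_corner l; lia.
    by have := x_corner l; lia.
  move=> /(congr1 (fun v : vec d => v p)); rewrite corner_p xl //; first by lia.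
  by rewrite eq_sym.
- rewrite YE => E.
  have : corner = y.
    apply: (@lift_uniq _ _ N_gt0 corner _ _ _ _ E) => l; last by have := corner_y l; lia.
    by have := corner_y l; lia.
  move=> /(congr1 (fun v : vec d => v (ordS k))); rewrite corner_s yl //; lia.
- by rewrite XE; apply: (precedesI N_gt0).
- by rewrite YE; apply: (precedesI N_gt0).
Qed.

Lemma arrow_between_old X Y : D X -> D Y -> X <> arc_of N a -> Y <> arc_of N a ->
  qarr (arc_quiver d D) X Y <-> qarr (arc_quiver d D') X Y.
Proof.
move=> DX DY XA YA; split=> -[_ _ XY XpY none]; split=> //.
- exact: D'_D.
- exact: D'_D.
- case=> Z [/D'P [[DZ ZA]|->] ZX ZY XZ pZY]; first by apply: none; exists Z.
  exact: (new_not_between DX DY XZ pZY).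
case=> Z [DZ ZX ZY XZ pZY]; apply: none.
have [ZA|ZA] := pselect (Z = arc_of N a); last by exists Z; split=> //; apply: D'_D.
rewrite ZA in XZ pZY.
have [W [[DW WA] WX WY XW pWY]] := old_replaceable DX DY XA YA XZ pZY.
by exists W; split=> //; apply: D'_D.
Qed.

End HigherDimension.

End FlipCombinatorics.

(** * Orbits and distinguished cycles *)

Section OrbitVertices.
Variables (d n N : nat).
Implicit Types (a b x y c : vec d) (i j k : 'I_d.+1).

Local Notation next := (next_entry N).
Local Notation ov := (orbit_vertex N).

Lemma rev_ordS k : rev_ord (ordS k) = ord_pred (rev_ord k).
Proof.
apply: ord_inj => /=; have := ltn_ord k.
rewrite -[(k.+1 %% d.+1)%N]/(nat_of_ord (ordS k)).
have [[-> ->] _|[lt _ ->] _] := ordS_cases k.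
  by rewrite /= !subSS subnn add0n subn0 modn_small.
rewrite !subSS (_ : (d - k + d.+1).-1 = (d - k.+1 + d.+1)%N); last by lia.
by rewrite modnDr modn_small //; lia.
Qed.

Lemma rev_ord_pred k : rev_ord (ord_pred k) = ordS (rev_ord k).
Proof. by rewrite -{2}(ord_predK k) rev_ordS ord_predK. Qed.

Lemma orbit_vertexE a i : ov a (rev_ord i) = next a i - a i - 2.
Proof. by rewrite ffunE rev_ordK. Qed.

Lemma orbit_vertexD a i : ov (a + unitvec i) = ov a + fvec (rev_ord i).
Proof.
apply: vec_ext => j; rewrite -[j]rev_ordK; move: (rev_ord j) => {}j.
rewrite !vecE !orbit_vertexE !nextE !vecE -rev_ord_pred !(inj_eq rev_ord_inj).
have -> : (ordS j == i) = (j == ord_pred i).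
  by rewrite -{1}(ord_predK i) (inj_eq (@ordS_inj _)).
by lia.
Qed.

Lemma orbit_vertex_shift a m : ov (a + ones d *~ m) = ov a.
Proof.
by apply: vec_ext => j; rewrite -[j]rev_ordK !orbit_vertexE !nextE !vecE; lia.
Qed.

Lemma orbit_vertex_inj a b : ov a = ov b -> exists m, b = a + ones d *~ m.
Proof.
move=> E; exists (b ord0 - a ord0); apply: vec_ext => i; rewrite !vecE.
suff : b i - a i = b ord0 - a ord0 by lia.
move: i; apply: (@cyclic_ind _ _ ord0) => // j jE.
have := congr1 (fun v : vec d => v (rev_ord j)) E.
by rewrite !orbit_vertexE !nextE; lia.
Qed.

Hypothesis N_E : N = (n + 2 * d + 1)%N.

Lemma orbit_vertex_cvert a : cvert n (ov a) <-> tvert N a.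
Proof.
have sumE : \sum_k ov a k = n%:Z - 1.
  rewrite (reindex_inj rev_ord_inj) /=.
  under eq_bigr do rewrite orbit_vertexE.
  rewrite sumrB sum_gaps sumr_const card_ord; lia.
split=> [[ge0 _]|ta].
  by apply/tvertP => i; have := ge0 (rev_ord i); rewrite orbit_vertexE; lia.
split=> // k; rewrite -[k]rev_ordK orbit_vertexE.
by move/tvertP: ta => /(_ (rev_ord k)); lia.
Qed.

Lemma orbit_vertex_surj c : cvert n c -> exists a, ov a = c.
Proof.
case=> c_ge0 c_sum.
pose a : vec d := [ffun i : 'I_d.+1 =>
  \sum_(j < d.+1 | (j < i)%N) (c (rev_ord j) + 2)].
have total : \sum_(j < d.+1) (c (rev_ord j) + 2) = N%:Z.
  rewrite big_split sumr_const card_ord /=.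
  have -> : \sum_(j < d.+1) c (rev_ord j) = n%:Z - 1.
    by rewrite -c_sum [RHS](reindex_inj rev_ord_inj).
  by rewrite N_E; lia.
exists a; apply: vec_ext => k; rewrite -[k]rev_ordK orbit_vertexE nextE /wrap !ffunE.
set i := rev_ord k; have [[iE SE]|[_ /negPf-> SE]] := ordS_cases i.
  rewrite SE (@big_pred0 _ _ _ _ _ (fun j : 'I_d.+1 => (j < ord0)%N)) // iE eqxx.
  move: total; rewrite (bigD1 ord_max) //= (eq_bigl (fun j : 'I_d.+1 => (j < d)%N)).
    by move=> <-; rewrite add0r addrK addrK.
  by move=> j; rewrite -val_eqE /=; have := ltn_ord j; lia.
rewrite SE (bigD1 i) //= (eq_bigl (fun j : 'I_d.+1 => (j < i)%N)) => [|j].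
  by rewrite addr0 addrK addrK.
by rewrite -val_eqE /=; lia.
Qed.

End OrbitVertices.

Section DistinguishedCycles.
Variables (d n : nat).
Implicit Types (x y c : vec d) (i j k : 'I_d.+1).

(** A distinguished cycle is an orbit of this map, which has period d + 1. *)
Definition walk_step (e : arrow d) : arrow d := (target e, ordS e.2).

(** The labels f_k telescope. *)
Lemma iter_walk_step l x k : iter l walk_step (x, k) =
  (x + unitvec (iter l (@ordS _) k) - unitvec k, iter l (@ordS _) k).
Proof.
elim: l => [|l /= ->] /=; first by rewrite addrK.
rewrite /walk_step /target /fvec /=; congr (_, _).
by apply: vec_ext => j; rewrite !vecE; lia.
Qed.

Lemma walk_traject l x k :
  walk x (traject (@ordS _) k l) = traject walk_step (x, k) l.
Proof. by elim: l x k => //= l IHl x k; rewrite IHl. Qed.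

Lemma rot_enum_ord k : rot k (enum 'I_d.+1) = traject (@ordS _) k d.+1.
Proof.
apply: (@eq_from_nth _ k); first by rewrite size_rot size_enum_ord size_traject.
move=> i; rewrite size_rot size_enum_ord => lt; apply: ord_inj.
rewrite nth_traject // iter_ordS /rot nth_cat size_drop size_enum_ord nth_drop.
case: ltnP => [lt2|ge]; first by rewrite nth_enum_ord ?modn_small //; lia.
have -> : (k + i = i - (d.+1 - k) + d.+1)%N by have := ltn_ord k; lia.
rewrite modnDr nth_take; last by lia.
by rewrite nth_enum_ord ?modn_small; lia.
Qed.

Lemma rot_enum_traject m : exists k,
  rot m (enum 'I_d.+1) = traject (@ordS _) k d.+1.
Proof.
have [lt|ge] := ltnP m d.+1; first by exists (Ordinal lt); rewrite -rot_enum_ord.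
by exists ord0; rewrite -rot_enum_ord rot0 rot_oversize // size_enum_ord.
Qed.

Lemma walk_period e : iter d.+1 walk_step e = e.
Proof.
case: e => x k; rewrite iter_walk_step.
have -> : iter d.+1 (@ordS _) k = k.
  by apply: ord_inj; rewrite iter_ordS modnDr modn_small.
by rewrite addrK.
Qed.

Lemma distinguished_step x ks e :
  distinguished_cycle n x ks -> e \in walk x ks -> walk_step e \in walk x ks.
Proof.
move=> [_ [m ->]]; have [k ->] := rot_enum_traject m; rewrite walk_traject.
move=> /trajectP [l lt ->]; apply/trajectP; rewrite -iterS.
have [ld|ge] := ltnP l d; first by exists l.+1.
by exists 0%N => //; have -> : l = d by [lia]; rewrite walk_period.
Qed.

Lemma distinguished_pred x ks y k : distinguished_cycle n x ks ->
  (y, k) \in walk x ks -> (y - fvec (ord_pred k), ord_pred k) \in walk x ks.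
Proof.
move=> dist yk.
rewrite -[X in X \in _]walk_period iterSr.
rewrite [X in iter d _ X](_ : _ = (y, k)); last first.
  by rewrite /walk_step /target /= ord_predK subrK.
have iter_in l : iter l walk_step (y, k) \in walk x ks.
  by elim: l => //= l; apply: distinguished_step.
exact: iter_in.
Qed.

Lemma distinguished_from c k : cvert n c -> 1 <= c k ->
  distinguished_cycle n c (traject (@ordS _) k d.+1).
Proof.
move=> [c_ge0 c_sum] ck; split; last by exists k; rewrite rot_enum_ord.
have cv l : cvert n (c + unitvec l - unitvec k).
  split=> [j|].
    have := c_ge0 j; rewrite !vecE; have [->|_] := eqVneq j k; lia.
  under eq_bigr do rewrite !vecE.
  have sum1 i : \sum_(j < d.+1) (j == i)%:R = 1 :> int.
    by rewrite (bigD1 i) //= eqxx big1 ?addr0 // => j /negPf->.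
  by rewrite sumrB big_split /= c_sum !sum1; lia.
split; first exact: size_traject.
  move=> e; rewrite walk_traject => /trajectP [l _ ->]; split.
    by rewrite iter_walk_step; apply: cv.
  rewrite -[target _]/(walk_step (iter l walk_step (c, k))).1 -iterS.
  by rewrite iter_walk_step; apply: cv.
rewrite -rot_enum_ord (perm_big (enum 'I_d.+1)) ?perm_rot // big_enum /= sumrB.
by rewrite [X in _ + (_ - X)](reindex_inj (@ordS_inj d.+1)) /= subrr addr0.
Qed.

Lemma cut_quiver_no_loop (C : set (arrow d)) x :
  (0 < d)%N -> ~ qarr (cut_quiver n C) x x.
Proof.
move=> d_gt0 [k [_ _ /(congr1 (fun v : vec d => v k))]].
by rewrite /target /fvec /= !vecE eqxx eq_sym (negPf (ordS_neq k d_gt0)); lia.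
Qed.

End DistinguishedCycles.

(** * The cut of a slice and its mutation *)

Section SliceCut.
Variables (d n N : nat) (S : set (vec d)).
Hypotheses (d_gt0 : (0 < d)%N) (N_E : N = (n + 2 * d + 1)%N)
  (sliceS : is_slice N S).
Implicit Types (x y c : vec d) (i j l : 'I_d.+1).

Local Notation ov := (orbit_vertex N).
Local Notation C := (slice_cut n N S).

Lemma orbit_vertex_slice_inj x y : S x -> S y -> ov x = ov y -> x = y.
Proof.
move=> Sx Sy /(orbit_vertex_inj) [m yE]; rewrite yE in Sy *.
by rewrite (slice_uniq sliceS Sx Sy) mulr0z addr0.
Qed.

Lemma orbit_vertex_slice_surj c : cvert n c -> exists2 x, S x & ov x = c.
Proof.
move=> cc; have [a aE] := orbit_vertex_surj N_E cc.
have ta : tvert N a by apply/(orbit_vertex_cvert N_E); rewrite aE.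
have [m Sm] := slice_rep sliceS ta.
by exists (a + ones d *~ m) => //; rewrite orbit_vertex_shift.
Qed.

Lemma carrowsE x i : tvert N x ->
  carrows n (ov x, rev_ord i) <-> tvert N (x + unitvec i).
Proof.
move=> tx; rewrite /carrows /target /= -orbit_vertexD.
split=> [[_ /(orbit_vertex_cvert N_E)//]|txi].
by split; apply/(orbit_vertex_cvert N_E).
Qed.

Lemma slice_cutE x i : S x ->
  C (ov x, rev_ord i) <-> tvert N (x + unitvec i) /\ ~ S (x + unitvec i).
Proof.
move=> Sx; rewrite /slice_cut /arrow_type /= rev_ordK.
rewrite carrowsE; last exact: (slice_tvert sliceS).
split=> -[tx notS]; split=> //; first by move=> Sxi; apply: notS; exists x.
move=> [y [Sy Syi]] /(orbit_vertex_slice_inj Sy Sx) yx.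
by rewrite yx in Syi.
Qed.

Variables (a : vec d) (k : 'I_d.+1).
Local Notation next := (next_entry N).
Local Notation p := (ord_pred k).
Hypotheses (gap_p : a p + 3 <= next a p) (gap_k : a k + 3 <= next a k)
  (gap_other : forall l, l != k -> l != p -> next a l = a l + 2).
Local Notation before := (a + ones d - unitvec k).
Local Notation after := (a - ones d + unitvec k).
Hypotheses (Sa : S a) (S_up : S (a + unitvec p)) (S_down : S (a - unitvec (ordS k)))
  (S_before : S before) (S_after : S after).

Let ta : tvert N a. Proof. exact: (slice_tvert sliceS). Qed.

Let not_up_k : ~ S (a + unitvec k).
Proof.
have -> : a + unitvec k = after + ones d *~ 1.
  by apply: vec_ext => l; rewrite !vecE; lia.
by move=> /(slice_uniq sliceS S_after).
Qed.

Let not_down_k : ~ S (a - unitvec k).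
Proof.
have -> : a - unitvec k = before + ones d *~ (-1).
  by apply: vec_ext => l; rewrite !vecE; lia.
by move=> /(slice_uniq sliceS S_before).
Qed.

Let wide i : a i + 3 <= next a i -> i = k \/ i = p.
Proof.
move=> gap; have [->|ik] := eqVneq i k; first by left.
have [->|ip] := eqVneq i p; first by right.
by have := gap_other ik ip; lia.
Qed.

Let out_cases i : tvert N (a + unitvec i) -> i = k \/ i = p.
Proof. by move=> /(tvert_addP d_gt0 i ta)/wide. Qed.

Let in_cases i : tvert N (a - unitvec i) -> i = ordS k \/ i = k.
Proof.
rewrite -{1}[i]ord_predK => /(tvert_subP d_gt0 _ ta)/wide.
by case=> [<-|/ord_pred_inj->]; [left; rewrite ord_predK|right].
Qed.

Let up_kC : C (ov a, rev_ord k).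
Proof. by apply/slice_cutE => //; split=> //; apply/tvert_addP. Qed.

Let before_up : before + unitvec k = a + ones d *~ 1.
Proof. by apply: vec_ext => l; rewrite !vecE; lia. Qed.

Let ov_before_up : ov before + fvec (rev_ord k) = ov a.
Proof. by rewrite -orbit_vertexD before_up orbit_vertex_shift. Qed.

Let before_kC : C (ov before, rev_ord k).
Proof.
apply/slice_cutE => //; rewrite before_up; split; first exact: tvert_shift.
by move=> /(slice_uniq sliceS Sa).
Qed.

(** A distinguished cycle through a that keeps an arrow at a either leaves a by
    type p, and then it enters a by the cut arrow of type k, or enters a by type
    k + 1, and then it leaves a by the cut arrow of type k. *)
Lemma cut_out_typeE j : is_cut n C -> cut_out_type n C (ov a) j <-> j = k.
Proof.
move=> [_ cutC]; split.
  move=> [x [ks [dist [[y r] yr [notC inc]] [e' e'w [Ce' typeE]]]]].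
  have [e0 [[e0w Ce0] uniq]] := cutC x ks dist.1.
  have same e : e \in walk x ks -> C e -> e = e'.
    by move=> ew Ce; rewrite -(uniq e') // -(uniq e).
  have [_ carr _] := dist.1.
  rewrite -typeE; have := carr _ yr; rewrite -[r]rev_ordK in yr notC inc *.
  set i := rev_ord r in yr notC inc *.
  case: inc => [/= yE|]; last rewrite /target /= => yE.
    rewrite yE in yr notC * => /(carrowsE _ ta) ti.
    have Si : S (a + unitvec i).
      by apply: contrapT => nS; apply: notC; apply/slice_cutE.
    have [iE|iE] := out_cases ti; first by rewrite iE in Si.
    have := distinguished_pred dist yr.
    rewrite iE -rev_ordS ord_predK.
    have -> : ov a - fvec (rev_ord k) = ov before by rewrite -ov_before_up addrK.
    by move=> /same/(_ before_kC) <-; rewrite /arrow_type /= rev_ordK.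
  move=> [/= cy _]; have [b Sb bE] := orbit_vertex_slice_surj cy.
  rewrite -bE in cy yE yr notC.
  have Si : S (b + unitvec i).
    apply: contrapT => nS; apply: notC; apply/slice_cutE => //; split=> //.
    apply/(orbit_vertex_cvert N_E); rewrite orbit_vertexD yE.
    exact/(orbit_vertex_cvert N_E).
  rewrite -orbit_vertexD in yE.
  have baE := orbit_vertex_slice_inj Si Sa yE.
  have bE' : b = a - unitvec i by rewrite -baE addrK.
  have [iE|iE] : i = ordS k \/ i = k.
  - by apply: in_cases; rewrite -bE'; apply: (slice_tvert sliceS).
  - have := distinguished_step dist yr.
    rewrite /walk_step /target /= -orbit_vertexD yE iE.
    have -> : ordS (rev_ord (ordS k)) = rev_ord k by rewrite rev_ordS ord_predK.
    by move=> /same/(_ up_kC) <-; rewrite /arrow_type /= rev_ordK.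
  - by case: not_down_k; rewrite -iE -bE'.
move=> ->.
have ova : cvert n (ov a) by apply/(orbit_vertex_cvert N_E).
have ova1 : 1 <= ov a (rev_ord p) by rewrite orbit_vertexE; lia.
have dist := distinguished_from ova ova1.
exists (ov a), (traject (@ordS _) (rev_ord p) d.+1); split=> //.
  exists (ov a, rev_ord p); first by rewrite /= inE eqxx.
  by split; [move=> /slice_cutE[] | left].
exists (ov before, rev_ord k); last by split=> //; rewrite /arrow_type /= rev_ordK.
rewrite -[ov before](addrK (fvec (rev_ord k))) ov_before_up.
have -> : rev_ord k = ord_pred (rev_ord p) by rewrite -rev_ordS ord_predK.
by apply: (distinguished_pred dist); rewrite /= inE eqxx.
Qed.

Local Notation M := (mutated_cut n C (ov a)).
Local Notation arrow_in x y := (qarr (cut_quiver n M) (ov x) (ov y)).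

(** At a, the mutation exchanges the arrows inside and outside the cut. *)
Lemma mutated_incident e : carrows n e -> incident (ov a) e -> ~ M e <-> C e.
Proof.
move=> ce ie; split=> [notM|Ce [[_ //]|[[_ //] _]]].
by apply: contrapT => nC; apply: notM; right.
Qed.

Lemma mutated_not_incident e : ~ incident (ov a) e -> M e <-> C e.
Proof. by move=> ie; split=> [[[]//|[_ //]]|Ce]; left. Qed.

Lemma mutated_arrow_into x : S x -> x <> a -> arrow_in x a <-> x = before.
Proof.
move=> Sx xa; have tx := slice_tvert sliceS Sx; split.
  move=> [r []]; rewrite -[r]rev_ordK; move: (rev_ord r) => {r} i carr notM aE.
  have inc : incident (ov a) (ov x, rev_ord i) by right.
  have /slice_cutE[//|txi nS] := (mutated_incident carr inc).1 notM.
  move: aE; rewrite /target /= -orbit_vertexD => /orbit_vertex_inj [m xE].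
  have aE : a - unitvec i = x + ones d *~ (- m).
    by apply: vec_ext => l; move: (congr1 (fun v : vec d => v l) xE); rewrite !vecE; lia.
  have tai : tvert N (a - unitvec i) by rewrite aE; apply: tvert_shift.
  have [iE|iE] := in_cases tai.
    have := S_down; rewrite -iE aE => /(slice_uniq sliceS Sx) m0.
    case: nS; rewrite xE (_ : m = 0) ?mulr0z ?addr0 //; lia.
  have xE' : before = x + ones d *~ (1 - m).
    apply: vec_ext => l; move: (congr1 (fun v : vec d => v l) aE).
    by rewrite iE !vecE; lia.
  have := S_before; rewrite xE' => /(slice_uniq sliceS Sx) ->.
  by rewrite mulr0z addr0.
move=> xE; rewrite xE in Sx *.
have tb : tvert N (before + unitvec k) by rewrite before_up; apply: tvert_shift.
have inc : incident (ov a) (ov before, rev_ord k).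
  by right; rewrite /target /= ov_before_up.
have carr : carrows n (ov before, rev_ord k).
  by apply/carrowsE => //; apply: (slice_tvert sliceS).
exists (rev_ord k); split=> //; exact/mutated_incident.
Qed.

Lemma mutated_arrow_from y : S y -> arrow_in a y <-> y = after.
Proof.
have afterE : a + unitvec k = after + ones d *~ 1.
  by apply: vec_ext => l; rewrite !vecE; lia.
move=> Sy; split.
  move=> [r []]; rewrite -[r]rev_ordK; move: (rev_ord r) => {r} i carr notM yE.
  have inc : incident (ov a) (ov a, rev_ord i) by left.
  have /slice_cutE[//|tai nS] := (mutated_incident carr inc).1 notM.
  have [iE|iE] := out_cases tai; last by rewrite iE in nS.
  move: yE; rewrite /target /= -orbit_vertexD iE afterE orbit_vertex_shift.
  exact: orbit_vertex_slice_inj.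
move=> ->; have tk : tvert N (a + unitvec k) by apply/tvert_addP.
have inc : incident (ov a) (ov a, rev_ord k) by left.
have carr : carrows n (ov a, rev_ord k) by apply/carrowsE.
exists (rev_ord k); split=> //; first exact/mutated_incident.
by rewrite /target /= -orbit_vertexD afterE orbit_vertex_shift.
Qed.

Lemma mutated_arrow_old x y : S x -> S y -> x <> a -> y <> a ->
  arrow_in x y <-> qarr (slice_quiver N S) x y.
Proof.
move=> Sx Sy xa ya; have tx := slice_tvert sliceS Sx; have ty := slice_tvert sliceS Sy.
have not_inc i : y = x + unitvec i -> ~ incident (ov a) (ov x, rev_ord i).
  move=> yE [/= /(orbit_vertex_slice_inj Sx Sa)//|].
  by rewrite /target /= -orbit_vertexD -yE => /(orbit_vertex_slice_inj Sy Sa).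
split.
  move=> [r []]; rewrite -[r]rev_ordK; move: (rev_ord r) => {r} i carr notM yE.
  have not_inc' : ~ incident (ov a) (ov x, rev_ord i).
    case=> [/= /(orbit_vertex_slice_inj Sx Sa)//|].
    by rewrite -yE => /(orbit_vertex_slice_inj Sy Sa).
  have Sxi : S (x + unitvec i).
    apply: contrapT => nS; apply: notM; apply/mutated_not_incident => //.
    by apply/slice_cutE => //; split=> //; apply/carrowsE.
  have {}yE : y = x + unitvec i.
    by apply: orbit_vertex_slice_inj => //; rewrite yE orbit_vertexD.
  by split=> //; rewrite /tarrow tx ty; apply/existsP; exists i; apply/eqP.
move=> [_ _ /and3P [_ _ /existsP [i /eqP yE]]]; rewrite yE in ty Sy *.
exists (rev_ord i); split; first exact/carrowsE.
  by move=> /(mutated_not_incident (not_inc i yE))/(slice_cutE i Sx) [].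
by rewrite orbit_vertexD.
Qed.

End SliceCut.

(** * The flip *)

Section SliceVertex.
Variables (d N : nat) (S : set (vec d)) (D : set {set 'I_N}) (a : vec d).
Hypotheses (sliceS : is_slice N S) (Sa : S a)
  (isoS : quiver_iso (arc_of N) (slice_quiver N S) (arc_quiver d D)).

Lemma not_sink_arrow : ~ is_sink (arc_quiver d D) (arc_of N a) ->
  exists i, S (a + unitvec i).
Proof.
case: isoS => -[_ _ surj] arrS nsink; apply: contrapT => none; apply: nsink => Y AY.
have [_ DY _ _ _] := AY; have [y Sy yE] := surj _ DY.
rewrite -yE in AY; have [_ _ /and3P [_ _ /existsP [i /eqP E]]] := (arrS _ _ Sa Sy).2 AY.
by apply: none; exists i; rewrite -E.
Qed.

Lemma not_source_arrow : ~ is_source (arc_quiver d D) (arc_of N a) ->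
  exists i, S (a - unitvec i).
Proof.
case: isoS => -[_ _ surj] arrS nsource; apply: contrapT => none; apply: nsource => Y AY.
have [DY _ _ _ _] := AY; have [y Sy yE] := surj _ DY.
rewrite -yE in AY; have [_ _ /and3P [_ _ /existsP [i /eqP E]]] := (arrS _ _ Sy Sa).2 AY.
by apply: none; exists i; rewrite E addrK.
Qed.

(** The forbidden path is a - E_i -> a -> a + E_(i-1), with r = s = 1. *)
Lemma no_retrograde_step i : ~ middle_of_retrograde d D (arc_of N a) ->
  S (a - unitvec i) -> ~ S (a + unitvec (ord_pred i)).
Proof.
case: isoS => _ arrS nret Sx Sz; apply: nret.
set x := a - unitvec i in Sx; set z := a + _ in Sz.
have tx := slice_tvert sliceS Sx; have tz := slice_tvert sliceS Sz.
have ta := slice_tvert sliceS Sa.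
have xa : x + unitvec i = a by rewrite subrK.
have arr1 : qarr (arc_quiver d D) (arc_of N x) (arc_of N a).
  apply/arrS => //; split=> //; rewrite /tarrow tx ta.
  by apply/existsP; exists i; rewrite xa.
have arr2 : qarr (arc_quiver d D) (arc_of N a) (arc_of N z).
  apply/arrS => //; split=> //; rewrite /tarrow ta tz.
  by apply/existsP; exists (ord_pred i).
exists [:: arc_of N x; arc_of N a; arc_of N z], 1%N; split=> //; split=> //.
  by case=> [|[|[]]].
case=> [|[]] // _; split; [exact: arr1|split; [exact: arr2|]].
exists x, i, 1, 1; split; first by rewrite !mulr1z xa.
move/tvertP: tx => tx.
by split=> //; [have := tx i | have := tx (ord_pred i)]; lia.
Qed.

Hypothesis d_gt0 : (0 < d)%N.

Lemma slice_big i : S (a + unitvec i) -> (2 * d.+1 < N)%N.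
Proof.
move=> Si; have ta := slice_tvert sliceS Sa.
have gap : a i + 3 <= next_entry N a i.
  exact/(tvert_addP d_gt0 i ta)/(slice_tvert sliceS).
suff : 3 + \sum_(j < d.+1 | j != i) 2 <= N%:Z.
  by rewrite sumr_const cardC1 card_ord /=; lia.
rewrite -(sum_gaps N a) [leRHS](bigD1 i) //=; apply: lerD; first by lia.
by apply: ler_sum => j _; move/tvertP: ta => /(_ j); lia.
Qed.

End SliceVertex.

Section FlippedQuiver.
Variables (d n N : nat) (S : set (vec d)) (D D' : set {set 'I_N}) (a : vec d)
  (B : {set 'I_N}).
Hypotheses (isoS : quiver_iso (arc_of N) (slice_quiver N S) (arc_quiver d D))
  (D'E : D' = (D `\ arc_of N a) `|` [set B]) (notDB : ~ D B).
Local Notation ov := (orbit_vertex N).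

(** The inverse of [arc_of] on S. *)
Definition slice_lift X : vec d := xget 0 [set x | S x /\ arc_of N x = X].

Definition relabel X : vec d := ov (if `[< X = B >] then a else slice_lift X).

Lemma relabel_new : relabel B = ov a.
Proof. by rewrite /relabel asboolT. Qed.

Lemma relabel_old x : S x -> relabel (arc_of N x) = ov x.
Proof.
case: isoS => -[funS injS _] _ Sx; rewrite /relabel asboolF => [|E]; last first.
  by apply: notDB; rewrite -E; apply: funS.
congr ov; rewrite /slice_lift; case: xgetP => [y _ [Sy E]|/(_ x) /not_andP [] //].
by apply: injS => //; rewrite inE.
Qed.

Lemma relabel_cases X : D' X ->
  X = B \/ exists x, [/\ S x, x <> a & X = arc_of N x].
Proof.
case: isoS => -[_ _ surj] _; rewrite D'E => -[[DX XA]|]; last by left.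
have [x Sx xE] := surj _ DX; right; exists x; split=> // xa.
by apply: XA; rewrite -xE xa.
Qed.

End FlippedQuiver.

(* The second part carries the restriction 2 <= d because it fails for d = 1.
   Take n = 3 and the fan triangulation {02, 03, 04} of a hexagon with vertices
   0, .., 5, whose quiver is 02 -> 03 -> 04, and flip A = 03: the quiver of
   {02, 24, 04} is an oriented 3-cycle, whereas the new set of arrows C' leaves
   only the path 04 -> 24 -> 02. *)
Theorem proposition4p16 (R : realType) (d n N : nat) (t : 'I_N -> R)
    (T T' : {set {set 'I_N}}) (S : set (vec d)) (C : set (arrow d))
    (A : vec d) (B : {set 'I_N}) :
  (1 <= d)%N -> N = (n + 2 * d + 1)%N ->
  (forall i j : 'I_N, (i < j)%N -> t i < t j) ->
  triangulation d t T ->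
  is_slice N S ->
  quiver_iso (arc_of N) (slice_quiver N S) (arc_quiver d (darcs d t T)) ->
  is_cut n C -> C = slice_cut n N S ->
  S A ->
  ~ is_sink (arc_quiver d (darcs d t T)) (arc_of N A) ->
  ~ is_source (arc_quiver d (darcs d t T)) (arc_of N A) ->
  ~ middle_of_retrograde d (darcs d t T) (arc_of N A) ->
  bistellar_flip d t T (arc_of N A) T' B ->
  (exists2 i : 'I_d.+1,
     forall j, cut_out_type n C (orbit_vertex N A) j <-> j = i &
     B = arc_of N (flipped N A i)) /\
  ((2 <= d)%N -> exists psi : {set 'I_N} -> vec d,
     [/\ quiver_iso psi (arc_quiver d (darcs d t T'))
           (cut_quiver n (mutated_cut n C (orbit_vertex N A))),
         psi B = orbit_vertex N A &
         forall A', S A' -> A' <> A -> psi (arc_of N A') = orbit_vertex N A']).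
Proof.
move=> d_gt0 N_E t_inc triT sliceS isoS cutC CE SA nsink nsource nret flip.
rewrite {}CE in cutC *.
have N_gt0 : (0 < N)%N by lia.
have [triT' _ notTB T'E] := flip.
have [i Si] := not_sink_arrow SA isoS nsink.
have [j Sj] := not_source_arrow SA isoS nsource.
have N_big := slice_big sliceS SA d_gt0 Si.
have no_retro l := no_retrograde_step sliceS SA isoS (i := l) nret.
have [k [[gap_p gap_k gap_other] [S_up S_before S_down S_after]]] :=
  flip_type sliceS d_gt0 N_big SA no_retro Si Sj.
have [[funS injS surjS] arrS] := isoS.
have arcD x : S x -> darcs d t T (arc_of N x) by apply: funS.
have arc_inj x y : S x -> S y -> arc_of N x = arc_of N y -> x = y.
  by move=> Sx Sy; apply: injS; rewrite inE.
have crossD X Y : darcs d t T X -> darcs d t T Y -> ~ intertwining d X Y.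
  exact: triangulation_noncrossing.
have crossD' X Y : darcs d t T' X -> darcs d t T' Y -> ~ intertwining d X Y.
  exact: triangulation_noncrossing.
have AB : intertwining d (arc_of N A) B by apply: flip_intertwining flip.
have BE : B = arc_of N (flipped N A k).
  exact: (flipped_arc d_gt0 N_big sliceS arcD arc_inj crossD' T'E gap_p gap_k).
split.
  exists k => // l; exact: (cut_out_typeE d_gt0 N_E sliceS gap_p gap_k gap_other).
move=> d_gt1; exists (relabel S A B).
have oldE x : S x -> relabel S A B (arc_of N x) = orbit_vertex N x.
  exact: (relabel_old A isoS notTB).
have newE : relabel S A B B = orbit_vertex N A by apply: relabel_new.
split=> [||x Sx _]; [|exact: newE|exact: oldE].
have cases X : darcs d t T' X ->
    X = B \/ exists x, [/\ S x, x <> A & X = arc_of N x].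
  exact: (relabel_cases isoS T'E).
have ov_inj := orbit_vertex_slice_inj sliceS.
have D'arc x : S x -> x <> A -> darcs d t T' (arc_of N x).
  by move=> Sx xA; rewrite T'E; left; split; [exact: arcD|move=> /(arc_inj _ _ Sx SA)].
have neqB x : S x -> arc_of N x <> B.
  by move=> Sx xB; apply: notTB; rewrite -xB; apply: arcD.
have neqA x : S x -> x <> A -> arc_of N x <> arc_of N A.
  by move=> Sx xA /(arc_inj _ _ Sx SA).
split.
  split.
  - move=> X /cases [->|[x [Sx _ ->]]]; rewrite ?newE ?oldE //=.
      by apply/(orbit_vertex_cvert N_E)/(slice_tvert sliceS).
    by apply/(orbit_vertex_cvert N_E)/(slice_tvert sliceS).
  - move=> X Y; rewrite !inE => /cases [->|[x [Sx xA ->]]] /cases [->|[y [Sy yA ->]]] //;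
      rewrite ?newE ?oldE //.
    + by move=> /(ov_inj _ _ SA Sy)/esym.
    + by move=> /(ov_inj _ _ Sx SA).
    + by move=> /(ov_inj _ _ Sx Sy)->.
  - move=> c cc; have [x Sx xE] := orbit_vertex_slice_surj N_E sliceS cc.
    have [xA|xA] := pselect (x = A).
      by exists B; rewrite ?newE -?xA //; rewrite /= T'E; right.
    by exists (arc_of N x); [exact: D'arc|rewrite oldE].
move=> X Y D'X D'Y.
set QT' := arc_quiver d (darcs d t T'); set QC' := cut_quiver n _.
have [XB|[x [Sx xA XE]]] := cases X D'X; have [YB|[y [Sy yA YE]]] := cases Y D'Y.
- rewrite XB YB newE; split; first by case.
  by move=> /(cut_quiver_no_loop d_gt0).
- rewrite XB YE newE oldE //.
  have -> : qarr QT' B (arc_of N y) <-> arc_of N y = arc_of N (A - ones d + unitvec k).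
    apply: (arrow_from_new d_gt0 N_big sliceS arcD arc_inj crossD T'E notTB
      gap_p gap_k) => //.
    + by rewrite -YE.
    + exact: neqB.
  have -> : qarr QC' (orbit_vertex N A) (orbit_vertex N y) <->
      y = A - ones d + unitvec k.
    exact: (mutated_arrow_from d_gt0 N_E sliceS gap_p gap_k gap_other).
  by split=> [/(arc_inj _ _ Sy S_after)|->].
- rewrite XE YB newE oldE //.
  have -> : qarr QT' (arc_of N x) B <-> arc_of N x = arc_of N (A + ones d - unitvec k).
    apply: (arrow_into_new d_gt0 N_big sliceS arcD arc_inj crossD T'E notTB
      gap_p gap_k) => //.
    + by rewrite -XE.
    + exact: neqB.
  have -> : qarr QC' (orbit_vertex N x) (orbit_vertex N A) <->
      x = A + ones d - unitvec k.
    exact: (mutated_arrow_into d_gt0 N_E sliceS gap_p gap_k gap_other).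
  by split=> [/(arc_inj _ _ Sx S_before)|->].
- rewrite XE YE !oldE //.
  have <- : qarr (arc_quiver d (darcs d t T)) (arc_of N x) (arc_of N y) <->
      qarr QT' (arc_of N x) (arc_of N y).
    by apply: (arrow_between_old d_gt0 N_big sliceS arcD arc_inj crossD T'E
      gap_p gap_k) => //; auto.
  have -> : qarr QC' (orbit_vertex N x) (orbit_vertex N y) <->
      qarr (slice_quiver N S) x y.
    exact: (mutated_arrow_old N_E sliceS).
  by rewrite (arrS x y Sx Sy).
Qed.
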